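(* Let $T=[v_1,v_2,v_3]$ and $\tilde T=[v_1,v_2,\tilde v_3]$ be nondegenerate triangles in $\mathbb{R}^2$ sharing the edge $e=[v_1,v_2]$, with bases $\{w_iQ_i\}_{i=1}^{39}$ of $\mathcal{S}^3_5(T_{12})$ and $\{w_i\tilde Q_i\}_{i=1}^{39}$ of $\mathcal{S}^3_5(\tilde T_{12})$ as defined in the context, and let $f=\sum_{i=1}^{39}c_iw_iQ_i$ on $T$ and $\tilde f=\sum_{i=1}^{39}\tilde c_iw_i\tilde Q_i$ on $\tilde T$ with real coefficients $c_i,\tilde c_i$. Let $(\beta_1,\beta_2,\beta_3)$ be the barycentric coordinates of $\tilde v_3$ with respect to $T$. Then $f$ and $\tilde f$ meet along $e$ with **$C^0$ smoothness** if and only if $\tilde c_i=c_i$ for $i=1,\dots,8$; **$C^1$ smoothness** if and only if in addition $$\begin{aligned} \tilde c_9&=\beta_1c_1+\beta_2c_2+\beta_3c_9,\qquad \tilde c_{15}=\beta_1c_7+\beta_2c_8+\beta_3c_{15},\\ \tilde c_{10}&=\beta_1c_2+\beta_2c_3+\beta_3c_{10},\qquad \tilde c_{14}=\beta_1c_6+\beta_2c_7+\beta_3c_{14},\\ \tilde c_{11}&=\beta_1(2c_3-c_2)+\beta_2c_4+\beta_3c_{11},\qquad \tilde c_{13}=\beta_1c_5+\beta_2(2c_6-c_7)+\beta_3c_{13},\\ \tilde c_{12}&=\beta_1\tfrac{2c_4+c_5}3+\beta_2\tfrac{c_4+2c_5}3+\beta_3c_{12}; \end{aligned}$$ **$C^2$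 smoothness** if and only if in addition $$\begin{aligned} \tilde c_{16}&=\beta_1^2c_1+2\beta_1\beta_2c_2+\beta_2^2c_3+2\beta_1\beta_3c_9+2\beta_2\beta_3c_{10}+\beta_3^2c_{16},\\ \tilde c_{17}&=\beta_1^2c_2+\beta_2^2c_4+\beta_3^2c_{17}+2\beta_1\beta_2\tfrac{3c_3-c_2}2+2\beta_1\beta_3\tfrac{3c_{10}-c_2}2+2\beta_2\beta_3\tfrac{c_{10}+2c_{11}-c_3}2,\\ \tilde c_{18}&=\beta_1^2\tfrac{2c_3+2c_4-c_2}3+\beta_2^2\tfrac{c_4+2c_5}3+\beta_3^2c_{18}+2\beta_1\beta_2\tfrac{c_2-2c_3+6c_4+c_5}6\\ &\quad+2\beta_1\beta_3\tfrac{c_2-2c_3+2c_4-c_5+3c_{11}+3c_{12}}6+2\beta_2\beta_3\tfrac{9c_{12}-2c_5-c_{11}}6,\\ \tilde c_{19}&=\beta_1^2\tfrac{2c_4+c_5}3+\beta_2^2\tfrac{2c_5+2c_6-c_7}3+\beta_3^2c_{19}+2\beta_1\beta_2\tfrac{c_4+6c_5-2c_6+c_7}6\\ &\quad+2\beta_2\beta_3\tfrac{c_7-2c_6+2c_5-c_4+3c_{13}+3c_{12}}6+2\beta_1\beta_3\tfrac{9c_{12}-2c_4-c_{13}}6,\\ \tilde c_{20}&=\beta_1^2c_5+\beta_2^2c_7+\beta_3^2c_{20}+2\beta_1\beta_2\tfrac{3c_6-c_7}2+2\beta_1\beta_3\tfrac{c_{14}+2c_{13}-c_6}2+2\beta_2\beta_3\tfrac{3c_{14}-c_7}2,\\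 \tilde c_{21}&=\beta_1^2c_6+2\beta_1\beta_2c_7+\beta_2^2c_8+2\beta_1\beta_3c_{14}+2\beta_2\beta_3c_{15}+\beta_3^2c_{21}; \end{aligned}$$ **$C^3$ smoothness** if and only if in addition $$\begin{aligned} \tilde c_{22}&=\beta_1^3c_1+3\beta_1^2\beta_2\tfrac{4c_2-c_1}3+3\beta_1\beta_2^2\tfrac{5c_3-2c_2}3+\beta_2^3c_4+3\beta_2^2\beta_3\tfrac{c_{10}-c_3+3c_{11}}3\\ &\quad+3\beta_2\beta_3^2\tfrac{c_{10}-c_{16}+3c_{17}}3+\beta_3^3c_{22}+3\beta_3^2\beta_1\tfrac{5c_{16}-2c_9}3+3\beta_3\beta_1^2\tfrac{4c_9-c_1}3+6\beta_1\beta_2\beta_3\tfrac{5c_{10}-c_2-c_9}3,\\ \tilde c_{23}&=\beta_1^3\tfrac{c_2+2c_3}3+3\beta_1^2\beta_2\tfrac{-2c_2+8c_3+3c_4}9+3\beta_1\beta_2^2\tfrac{c_2-c_3+8c_4+c_5}9+\beta_2^3\tfrac{c_4+2c_5}3\\ &\quad+3\beta_2^2\beta_3\tfrac{c_{10}+15c_{12}-c_3-2c_4-4c_5}9+3\beta_2\beta_3^2\tfrac{-6c_{12}+2c_{17}+12c_{18}-c_4+2c_5}9\\ &\quad+3\beta_1\beta_3^2\tfrac{c_{10}+3c_{11}-3c_{12}+5c_{17}+3c_{18}+c_2-2c_3+c_5}9+3\beta_1^2\beta_3\tfrac{8c_{10}+3c_{11}-2c_2}9\\ &\quad+6\beta_1\beta_2\beta_3\tfrac{3c_{10}+6c_{11}+3c_{12}+c_2-4c_3+c_4-c_5}9+\beta_3^3c_{23},\\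 \tilde c_{24}&=\beta_1^3\tfrac{2c_4+c_5}3+3\beta_1^2\beta_2\tfrac{c_4+8c_5-c_6+c_7}9+3\beta_1\beta_2^2\tfrac{3c_5+8c_6-2c_7}9+\beta_2^3\tfrac{2c_6+c_7}3\\ &\quad+3\beta_2^2\beta_3\tfrac{3c_{13}+8c_{14}-2c_7}9+3\beta_2\beta_3^2\tfrac{-3c_{12}+3c_{13}+c_{14}+3c_{19}+5c_{20}+c_4-2c_6+c_7}9\\ &\quad+3\beta_1\beta_3^2\tfrac{-6c_{12}+12c_{19}+2c_{20}+2c_4-c_5}9+3\beta_1^2\beta_3\tfrac{15c_{12}+c_{14}-4c_4-2c_5-c_6}9\\ &\quad+6\beta_1\beta_2\beta_3\tfrac{3c_{12}+6c_{13}+3c_{14}-c_4+c_5-4c_6+c_7}9+\beta_3^3c_{24},\\ \tilde c_{25}&=\beta_1^3c_5+3\beta_1^2\beta_2\tfrac{5c_6-2c_7}3+3\beta_1\beta_2^2\tfrac{4c_7-c_8}3+\beta_2^3c_8+3\beta_2^2\beta_3\tfrac{4c_{15}-c_8}3\\ &\quad+3\beta_2\beta_3^2\tfrac{5c_{21}-2c_{15}}3+3\beta_3^2\beta_1\tfrac{c_{14}+3c_{20}-c_{21}}3+3\beta_3\beta_1^2\tfrac{3c_{13}+c_{14}-c_6}3\\ &\quad+6\beta_1\beta_2\beta_3\tfrac{5c_{14}-c_7-c_{15}}3+\beta_3^3c_{25},\\ 0&=(3\beta_1^2\beta_2-3\beta_1\beta_2^2)\tfrac{c_2-2c_3+2c_4-2c_5+2c_6-c_7}3\\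 &\quad+3\beta_1^2\beta_3\tfrac{c_{11}-3c_{12}+c_{13}+c_2-2c_3+2c_4}3+3\beta_2^2\beta_3\tfrac{c_{11}-3c_{12}+c_{13}+c_7-2c_6+2c_5}3\\ &\quad+3\beta_1\beta_3^2\tfrac{-5c_{11}+6c_{12}+c_{13}+9c_{18}-9c_{19}-2c_2+4c_3-4c_4}6\\ &\quad+3\beta_2\beta_3^2\tfrac{-5c_{13}+6c_{12}+c_{11}+9c_{19}-9c_{18}-2c_7+4c_6-4c_5}6\\ &\quad+6\beta_1\beta_2\beta_3\tfrac{-2c_{11}+6c_{12}-2c_{13}-c_2+2c_3-2c_4-2c_5+2c_6-c_7}3. \end{aligned}$$
   Context: **12-split.** For a nondegenerate triangle $T=[v_1,v_2,v_3]$ let $v_4=\frac{v_1+v_2}2$, $v_5=\frac{v_2+v_3}2$, $v_6=\frac{v_1+v_3}2$, $v_7=\frac{v_4+v_6}2$, $v_8=\frac{v_4+v_5}2$, $v_9=\frac{v_5+v_6}2$, $v_{10}=\frac{v_1+v_2+v_3}3$. The 12-split $T_{12}$ is the triangulation of $T$ into 12 triangles obtained by drawing the segments $[v_1,v_5],[v_2,v_6],[v_3,v_4],[v_4,v_5],[v_5,v_6],[v_4,v_6]$; its vertices are $v_1,\dots,v_{10}$. $\mathcal{S}^3_5(T_{12})$ is the (39-dimensional) space of $C^3$ functions on $T$ that are polynomials of total degree at most 5 on each of the 12 triangles. **Simplex splines.** For a finite multiset $K=\{v_1^{m_1}\cdots v_{10}^{m_{10}}\}$ let $|K|=\sum m_i$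 and $[K]$ its convex hull. For $x$ not on any line through two of the points $v_1,\dots,v_{10}$, define recursively $Q[K](x)=0$ if $\mathrm{area}([K])=0$; $Q[K](x)=\mathbf 1_{[K]}(x)\,\mathrm{area}(T)/\mathrm{area}([K])$ if $\mathrm{area}([K])\ne0$ and $|K|=3$; and $Q[K](x)=\sum_{j=1}^{10}\beta_jQ[K\setminus v_j](x)$ if $\mathrm{area}([K])\neq 0$ and $|K|>3$, where $x=\sum_j\beta_jv_j$, $\sum_j\beta_j=1$, $\beta_j=0$ whenever $m_j=0$, and $K\setminus v_j$ removes one copy of $v_j$ (the value does not depend on the choice of the $\beta_j$). On $T$ the function $Q[K]$ is extended by continuity (possible for all simplex splines used here). Write $Q_{ijklmn}:=Q[v_1^iv_2^jv_3^kv_4^lv_5^mv_6^n]$. **The basis $\mathcal{B}_c$.** Permutations of $v_1,v_2,v_3$ extend to affine maps of $T$ permuting $v_1,\dots,v_{10}$, giving a group $S_3$ of permutations. The basis $\mathcal{B}_c=\{w_iQ_i\}_{i=1}^{39}$ of $\mathcal{S}^3_5(T_{12})$ consists of all $wQ[\sigma(K)]$, $\sigma\in S_3$, with $wQ[K]$ among $\frac14Q_{600101},\frac14Q_{500201},\frac12Q_{410201},\frac12Q_{320201},\frac34Q_{220211},Q_{141110},\frac12Q_{131210},\frac34Q_{121211}$. It is ordered such that $w_1Q_1,\dots,w_{25}Q_{25}$ are, in this order, $$\begin{aligned} &\tfrac14Q_{600101},\tfrac14Q_{500201},\tfrac12Q_{410201},\tfrac12Q_{320201},\tfrac12Q_{230210},\tfrac12Q_{140210},\tfrac14Q_{050210},\tfrac14Q_{060110},\\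 &\tfrac14Q_{500102},Q_{411101},\tfrac12Q_{311201},\tfrac34Q_{220211},\tfrac12Q_{131210},Q_{141110},\tfrac14Q_{050120},\\ &\tfrac12Q_{401102},\tfrac12Q_{311102},\tfrac34Q_{211211},\tfrac34Q_{121211},\tfrac12Q_{131120},\tfrac12Q_{041120},\\ &\tfrac12Q_{302102},\tfrac34Q_{211112},\tfrac34Q_{121121},\tfrac12Q_{032120}, \end{aligned}$$ and $w_{26}Q_{26},\dots,w_{39}Q_{39}$ are the remaining elements of $\mathcal{B}_c$ in any fixed order. The functions $w_i\tilde Q_i$ are defined in the same way for the triangle $\tilde T$, with $v_3$ replaced by $\tilde v_3$ (and $v_5,\dots,v_{10}$ replaced accordingly). **Smooth join.** $f$ and $\tilde f$ meet along $e$ with $C^r$ smoothness if all partial derivatives of order at most $r$ of $f$ (taken from $T$) and of $\tilde f$ (taken from $\tilde T$) agree at every point of $e$. ''In addition'' means in addition to all conditions listed for lower orders of smoothness. *)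

(* Defs.v *)
From Stdlib Require Import Reals List Arith ClassicalEpsilon.
From Coquelicot Require Import Coquelicot.
Import ListNotations.
Open Scope R_scope.

Definition point : Type := (R * R)%type.

(* Twice the signed area of the triangle [a, b, c]. *)
Definition det (a b c : point) : R :=
  (fst b - fst a) * (snd c - snd a) - (fst c - fst a) * (snd b - snd a).

Definition triangle_area (a b c : point) : R := Rabs (det a b c) / 2.

Definition barycentric (a b c x : point) (b1 b2 b3 : R) : Prop :=
  b1 + b2 + b3 = 1 /\
  fst x = b1 * fst a + b2 * fst b + b3 * fst c /\
  snd x = b1 * snd a + b2 * snd b + b3 * snd c.

Definition midpoint (a b : point) : point :=
  ((fst a + fst b) / 2, (snd a + snd b) / 2).

(* The ten vertices of the 12-split, labelled 1, ..., 10 (other labels are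
   never used). *)
Definition vertex (v1 v2 v3 : point) (j : nat) : point :=
  let v4 := midpoint v1 v2 in
  let v5 := midpoint v2 v3 in
  let v6 := midpoint v1 v3 in
  match j with
  | 1%nat => v1
  | 2%nat => v2
  | 3%nat => v3
  | 4%nat => v4
  | 5%nat => v5
  | 6%nat => v6
  | 7%nat => midpoint v4 v6
  | 8%nat => midpoint v4 v5
  | 9%nat => midpoint v5 v6
  | _ => ((fst v1 + fst v2 + fst v3) / 3, (snd v1 + snd v2 + snd v3) / 3)
  end.

(* The multiset {v_1^m_1 ... v_10^m_10} is the list [m_1; ...; m_10]. *)
Definition multiset : Type := list nat.

Definition mult (K : multiset) (j : nat) : nat := nth (j - 1) K 0%nat.

Definition ms6 (i j k l m n : nat) : multiset :=
  [i; j; k; l; m; n; 0; 0; 0; 0]%nat.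

Definition ms_remove (l : nat) (K : multiset) : multiset :=
  map (fun j => if (j =? l)%nat then pred (mult K j) else mult K j) (seq 1 10).

Definition support (K : multiset) : list nat :=
  filter (fun j => (0 <? mult K j)%nat) (seq 1 10).

(* In the rest of the file, V : nat -> point gives the positions of the
   vertices labelled 1, ..., 10. *)

Definition hull (V : nat -> point) (K : multiset) (x : point) : Prop :=
  exists b : nat -> R,
    (forall j, 0 <= b j) /\
    (forall j, mult K j = 0%nat -> b j = 0) /\
    sum_n_m b 1 10 = 1 /\
    sum_n_m (fun j => b j * fst (V j)) 1 10 = fst x /\
    sum_n_m (fun j => b j * snd (V j)) 1 10 = snd x.

Definition whole_triangle : multiset := ms6 1 1 1 0 0 0.
Definition edge12 : multiset := ms6 1 1 0 0 0 0.

(* The first (lexicographically) affinely independent triple of points of K.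
   It is None exactly when the points of K are collinear, i.e. when
   area([K]) = 0; if |K| = 3 and it is Some (i, (j, k)), then [K] is the
   triangle with vertices V i, V j, V k. *)
Definition find_triangle (V : nat -> point) (K : multiset)
  : option (nat * (nat * nat)) :=
  find (fun t => if Req_EM_T (det (V (fst t)) (V (fst (snd t)))
                                  (V (snd (snd t)))) 0
                 then false else true)
    (list_prod (support K) (list_prod (support K) (support K))).

(* The coefficients b_l with x = sum_l b_l V l, sum_l b_l = 1 and b_l = 0 for
   l outside {i, j, k}, for an affinely independent triple i, j, k. *)
Definition bary_coeff (V : nat -> point) (i j k : nat) (x : point) (l : nat)
  : R :=
  let d := det (V i) (V j) (V k) in
  if (l =? i)%nat then det x (V j) (V k) / d
  else if (l =? j)%nat then det (V i) x (V k) / d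
  else if (l =? k)%nat then det (V i) (V j) x / d
  else 0.

(* The recurrence for Q[K](x), where n = |K| - 3.  The value of a simplex
   spline does not depend on the affine representation of x that is used in
   the recurrence; we fix the one given by find_triangle. *)
Fixpoint Q_rec (V : nat -> point) (n : nat) (K : multiset) (x : point) : R :=
  match find_triangle V K with
  | None => 0
  | Some (i, (j, k)) =>
      match n with
      | O =>
          (if excluded_middle_informative (hull V K x) then 1 else 0)
          * (triangle_area (V 1%nat) (V 2%nat) (V 3%nat)
             / triangle_area (V i) (V j) (V k))
      | S n' =>
          sum_n_m (fun l => bary_coeff V i j k x l
                            * Q_rec V n' (ms_remove l K) x) 1 10
      end
  end.

Definition Q_generic (V : nat -> point) (K : multiset) (x : point) : R :=
  Q_rec V (list_sum K - 3) K x.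

(* x is on no line through two of the ten vertices. *)
Definition generic (V : nat -> point) (x : point) : Prop :=
  forall i j, (1 <= i)%nat -> (i < j)%nat -> (j <= 10)%nat ->
    det (V i) (V j) x <> 0.

(* Q[K] on the triangle: the extension by continuity of its values at the
   generic points. *)
Definition Q (V : nat -> point) (K : multiset) (x : point) : R :=
  iota (fun y : R =>
    filterlim (Q_generic V K)
      (within (fun z => hull V whole_triangle z /\ generic V z) (locally x))
      (locally y)).

(* The permutation of 1, ..., 10, as the list of the images, induced by the
   permutation (a, b, c) of (1, 2, 3).  The midpoint of v_a and v_b has label
   4, 5, 6 according as a + b = 3, 5, 4; the midpoint of the two edge midpoints
   adjacent to v_a has label 6 + a. *)
Definition extend_perm (a b c : nat) : list nat :=
  let mid i j := match (i + j)%nat with 3 => 4 | 5 => 5 | _ => 6 end%nat in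
  [a; b; c; mid a b; mid b c; mid a c; 6 + a; 6 + b; 6 + c; 10]%nat.

Definition S3 : list (list nat) :=
  [extend_perm 1 2 3; extend_perm 1 3 2; extend_perm 2 1 3;
   extend_perm 2 3 1; extend_perm 3 1 2; extend_perm 3 2 1].

(* sigma(K): the multiplicity of i in sigma(K) is that of sigma^-1(i) in K. *)
Definition ms_image (s : list nat) (K : multiset) : multiset :=
  map (fun i => list_sum (map
         (fun j => if (nth (j - 1) s 0 =? i)%nat then mult K j else 0%nat)
         (seq 1 10)))
      (seq 1 10).

(* The weighted simplex spline w Q[K] is encoded by the pair (w, K). *)
Definition wspline : Type := (R * multiset)%type.

Definition Bc_representatives : list wspline :=
  [(1/4, ms6 6 0 0 1 0 1); (1/4, ms6 5 0 0 2 0 1);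
   (1/2, ms6 4 1 0 2 0 1); (1/2, ms6 3 2 0 2 0 1);
   (3/4, ms6 2 2 0 2 1 1); (1, ms6 1 4 1 1 1 0);
   (1/2, ms6 1 3 1 2 1 0); (3/4, ms6 1 2 1 2 1 1)].

Definition in_Bc (b : wspline) : Prop :=
  exists w K s, In (w, K) Bc_representatives /\ In s S3 /\
                b = (w, ms_image s K).

Definition Bc_first25 : list wspline :=
  [(1/4, ms6 6 0 0 1 0 1); (1/4, ms6 5 0 0 2 0 1);
   (1/2, ms6 4 1 0 2 0 1); (1/2, ms6 3 2 0 2 0 1);
   (1/2, ms6 2 3 0 2 1 0); (1/2, ms6 1 4 0 2 1 0);
   (1/4, ms6 0 5 0 2 1 0); (1/4, ms6 0 6 0 1 1 0);

   (1/4, ms6 5 0 0 1 0 2); (1, ms6 4 1 1 1 0 1);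
   (1/2, ms6 3 1 1 2 0 1); (3/4, ms6 2 2 0 2 1 1);
   (1/2, ms6 1 3 1 2 1 0); (1, ms6 1 4 1 1 1 0);
   (1/4, ms6 0 5 0 1 2 0);

   (1/2, ms6 4 0 1 1 0 2); (1/2, ms6 3 1 1 1 0 2);
   (3/4, ms6 2 1 1 2 1 1); (3/4, ms6 1 2 1 2 1 1);
   (1/2, ms6 1 3 1 1 2 0); (1/2, ms6 0 4 1 1 2 0);

   (1/2, ms6 3 0 2 1 0 2); (3/4, ms6 2 1 1 1 1 2);
   (3/4, ms6 1 2 1 1 2 1); (1/2, ms6 0 3 2 1 2 0)].

(* B lists the 39 elements of B_c without repetition, starting with the
   25 elements above; the order of the others is arbitrary. *)
Definition Bc_ordering (B : list wspline) : Prop :=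
  NoDup B /\ (forall b, In b B <-> in_Bc b) /\ firstn 25 B = Bc_first25.

(* c_1 w_1 Q_1 + ... + c_39 w_39 Q_39 *)
Definition spline (V : nat -> point) (B : list wspline) (c : nat -> R)
  (x : point) : R :=
  sum_n_m (fun i => let b := nth (i - 1) B (0, []) in
                    c i * (fst b * Q V (snd b) x)) 1 39.

Definition interior (A : point -> Prop) (x : point) : Prop := locally x A.

(* The partial derivative d^(m+k) f / dx^m dy^k at a point p of A, taken from
   A, is l: it is the limit of the derivative at the interior points of A. *)
Definition partial_from (A : point -> Prop) (m k : nat) (f : point -> R)
  (p : point) (l : R) : Prop :=
  filterlim
    (fun z : point =>
       partial_derive m k (fun x y => f (x, y)) (fst z) (snd z))
    (within (interior A) (locally p)) (locally l).

(* f on A and g on A' meet with C^r smoothness along e. *)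
Definition smooth_join (r : nat) (e A A' : point -> Prop) (f g : point -> R)
  : Prop :=
  forall m k, (m + k <= r)%nat -> forall p, e p ->
    exists l, partial_from A m k f p l /\ partial_from A' m k g p l.

(* The conditions on the coefficients c of f and d of f~ that are added for
   each order of smoothness; b1, b2, b3 are the barycentric coordinates of the
   third vertex of the second triangle with respect to the first one. *)

Definition C0_conditions (c d : nat -> R) : Prop :=
  forall i, (1 <= i)%nat -> (i <= 8)%nat -> d i = c i.

Local Notation "c .[ i ]" := (c (i)%nat)
  (at level 2, left associativity, format "c .[ i ]").

Definition C1_conditions (b1 b2 b3 : R) (c d : nat -> R) : Prop :=
  d.[9] = b1 * c.[1] + b2 * c.[2] + b3 * c.[9] /\
  d.[15] = b1 * c.[7] + b2 * c.[8] + b3 * c.[15] /\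
  d.[10] = b1 * c.[2] + b2 * c.[3] + b3 * c.[10] /\
  d.[14] = b1 * c.[6] + b2 * c.[7] + b3 * c.[14] /\
  d.[11] = b1 * (2 * c.[3] - c.[2]) + b2 * c.[4] + b3 * c.[11] /\
  d.[13] = b1 * c.[5] + b2 * (2 * c.[6] - c.[7]) + b3 * c.[13] /\
  d.[12] = b1 * ((2 * c.[4] + c.[5]) / 3) + b2 * ((c.[4] + 2 * c.[5]) / 3)
           + b3 * c.[12].

Definition C2_conditions (b1 b2 b3 : R) (c d : nat -> R) : Prop :=
  d.[16] = b1^2 * c.[1] + 2 * b1 * b2 * c.[2] + b2^2 * c.[3]
         + 2 * b1 * b3 * c.[9] + 2 * b2 * b3 * c.[10] + b3^2 * c.[16] /\
  d.[17] = b1^2 * c.[2] + b2^2 * c.[4] + b3^2 * c.[17]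
         + 2 * b1 * b2 * ((3 * c.[3] - c.[2]) / 2)
         + 2 * b1 * b3 * ((3 * c.[10] - c.[2]) / 2)
         + 2 * b2 * b3 * ((c.[10] + 2 * c.[11] - c.[3]) / 2) /\
  d.[18] = b1^2 * ((2 * c.[3] + 2 * c.[4] - c.[2]) / 3)
         + b2^2 * ((c.[4] + 2 * c.[5]) / 3) + b3^2 * c.[18]
         + 2 * b1 * b2 * ((c.[2] - 2 * c.[3] + 6 * c.[4] + c.[5]) / 6)
         + 2 * b1 * b3
           * ((c.[2] - 2 * c.[3] + 2 * c.[4] - c.[5]
               + 3 * c.[11] + 3 * c.[12]) / 6)
         + 2 * b2 * b3 * ((9 * c.[12] - 2 * c.[5] - c.[11]) / 6) /\
  d.[19] = b1^2 * ((2 * c.[4] + c.[5]) / 3)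
         + b2^2 * ((2 * c.[5] + 2 * c.[6] - c.[7]) / 3) + b3^2 * c.[19]
         + 2 * b1 * b2 * ((c.[4] + 6 * c.[5] - 2 * c.[6] + c.[7]) / 6)
         + 2 * b2 * b3
           * ((c.[7] - 2 * c.[6] + 2 * c.[5] - c.[4]
               + 3 * c.[13] + 3 * c.[12]) / 6)
         + 2 * b1 * b3 * ((9 * c.[12] - 2 * c.[4] - c.[13]) / 6) /\
  d.[20] = b1^2 * c.[5] + b2^2 * c.[7] + b3^2 * c.[20]
         + 2 * b1 * b2 * ((3 * c.[6] - c.[7]) / 2)
         + 2 * b1 * b3 * ((c.[14] + 2 * c.[13] - c.[6]) / 2)
         + 2 * b2 * b3 * ((3 * c.[14] - c.[7]) / 2) /\
  d.[21] = b1^2 * c.[6] + 2 * b1 * b2 * c.[7] + b2^2 * c.[8]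
         + 2 * b1 * b3 * c.[14] + 2 * b2 * b3 * c.[15] + b3^2 * c.[21].

Definition C3_conditions (b1 b2 b3 : R) (c d : nat -> R) : Prop :=
  d.[22] = b1^3 * c.[1]
         + 3 * b1^2 * b2 * ((4 * c.[2] - c.[1]) / 3)
         + 3 * b1 * b2^2 * ((5 * c.[3] - 2 * c.[2]) / 3)
         + b2^3 * c.[4]
         + 3 * b2^2 * b3 * ((c.[10] - c.[3] + 3 * c.[11]) / 3)
         + 3 * b2 * b3^2 * ((c.[10] - c.[16] + 3 * c.[17]) / 3)
         + b3^3 * c.[22]
         + 3 * b3^2 * b1 * ((5 * c.[16] - 2 * c.[9]) / 3)
         + 3 * b3 * b1^2 * ((4 * c.[9] - c.[1]) / 3)
         + 6 * b1 * b2 * b3 * ((5 * c.[10] - c.[2] - c.[9]) / 3) /\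
  d.[23] = b1^3 * ((c.[2] + 2 * c.[3]) / 3)
         + 3 * b1^2 * b2 * ((- 2 * c.[2] + 8 * c.[3] + 3 * c.[4]) / 9)
         + 3 * b1 * b2^2 * ((c.[2] - c.[3] + 8 * c.[4] + c.[5]) / 9)
         + b2^3 * ((c.[4] + 2 * c.[5]) / 3)
         + 3 * b2^2 * b3
           * ((c.[10] + 15 * c.[12] - c.[3] - 2 * c.[4] - 4 * c.[5]) / 9)
         + 3 * b2 * b3^2
           * ((- 6 * c.[12] + 2 * c.[17] + 12 * c.[18] - c.[4] + 2 * c.[5]) / 9)
         + 3 * b1 * b3^2
           * ((c.[10] + 3 * c.[11] - 3 * c.[12] + 5 * c.[17] + 3 * c.[18]
               + c.[2] - 2 * c.[3] + c.[5]) / 9)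
         + 3 * b1^2 * b3 * ((8 * c.[10] + 3 * c.[11] - 2 * c.[2]) / 9)
         + 6 * b1 * b2 * b3
           * ((3 * c.[10] + 6 * c.[11] + 3 * c.[12]
               + c.[2] - 4 * c.[3] + c.[4] - c.[5]) / 9)
         + b3^3 * c.[23] /\
  d.[24] = b1^3 * ((2 * c.[4] + c.[5]) / 3)
         + 3 * b1^2 * b2 * ((c.[4] + 8 * c.[5] - c.[6] + c.[7]) / 9)
         + 3 * b1 * b2^2 * ((3 * c.[5] + 8 * c.[6] - 2 * c.[7]) / 9)
         + b2^3 * ((2 * c.[6] + c.[7]) / 3)
         + 3 * b2^2 * b3 * ((3 * c.[13] + 8 * c.[14] - 2 * c.[7]) / 9)
         + 3 * b2 * b3^2
           * ((- 3 * c.[12] + 3 * c.[13] + c.[14] + 3 * c.[19] + 5 * c.[20]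
               + c.[4] - 2 * c.[6] + c.[7]) / 9)
         + 3 * b1 * b3^2
           * ((- 6 * c.[12] + 12 * c.[19] + 2 * c.[20] + 2 * c.[4] - c.[5]) / 9)
         + 3 * b1^2 * b3
           * ((15 * c.[12] + c.[14] - 4 * c.[4] - 2 * c.[5] - c.[6]) / 9)
         + 6 * b1 * b2 * b3
           * ((3 * c.[12] + 6 * c.[13] + 3 * c.[14]
               - c.[4] + c.[5] - 4 * c.[6] + c.[7]) / 9)
         + b3^3 * c.[24] /\
  d.[25] = b1^3 * c.[5]
         + 3 * b1^2 * b2 * ((5 * c.[6] - 2 * c.[7]) / 3)
         + 3 * b1 * b2^2 * ((4 * c.[7] - c.[8]) / 3)
         + b2^3 * c.[8]
         + 3 * b2^2 * b3 * ((4 * c.[15] - c.[8]) / 3)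
         + 3 * b2 * b3^2 * ((5 * c.[21] - 2 * c.[15]) / 3)
         + 3 * b3^2 * b1 * ((c.[14] + 3 * c.[20] - c.[21]) / 3)
         + 3 * b3 * b1^2 * ((3 * c.[13] + c.[14] - c.[6]) / 3)
         + 6 * b1 * b2 * b3 * ((5 * c.[14] - c.[7] - c.[15]) / 3)
         + b3^3 * c.[25] /\
  0 = (3 * b1^2 * b2 - 3 * b1 * b2^2)
        * ((c.[2] - 2 * c.[3] + 2 * c.[4] - 2 * c.[5] + 2 * c.[6] - c.[7]) / 3)
      + 3 * b1^2 * b3
        * ((c.[11] - 3 * c.[12] + c.[13] + c.[2] - 2 * c.[3] + 2 * c.[4]) / 3)
      + 3 * b2^2 * b3
        * ((c.[11] - 3 * c.[12] + c.[13] + c.[7] - 2 * c.[6] + 2 * c.[5]) / 3)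
      + 3 * b1 * b3^2
        * ((- 5 * c.[11] + 6 * c.[12] + c.[13] + 9 * c.[18] - 9 * c.[19]
            - 2 * c.[2] + 4 * c.[3] - 4 * c.[4]) / 6)
      + 3 * b2 * b3^2
        * ((- 5 * c.[13] + 6 * c.[12] + c.[11] + 9 * c.[19] - 9 * c.[18]
            - 2 * c.[7] + 4 * c.[6] - 4 * c.[5]) / 6)
      + 6 * b1 * b2 * b3
        * ((- 2 * c.[11] + 6 * c.[12] - 2 * c.[13]
            - c.[2] + 2 * c.[3] - 2 * c.[4] - 2 * c.[5]
            + 2 * c.[6] - c.[7]) / 3).

(* Main.v *)
Require Import Defs.
From Stdlib Require Import Reals List Lra Lia ZArith Bool FunctionalExtensionality.
From Coquelicot Require Import Coquelicot.
Import ListNotations.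
Open Scope R_scope.

(** Near the common edge e only six triangles of the 12-split occur, and in affine
coordinates (x, y) with v1 = (0,0), v2 = (2,0), v3 = (0,2) they are separated by the
five lines 1 - x = 0, 2 - 2x - y = 0, 1 - x - y = 0, y = x and x + 2y = 2, while e is
the segment y = 0, 0 <= x <= 2. The recurrence is affinely invariant
([Q_generic_chart]), so it suffices to know the simplex splines in these coordinates,
where v1, ..., v6 have integer coordinates.

On one triangle of the split every determinant det (v_i, v_j, x) with i, j <= 6 has a
constant sign, so the indicator functions at the bottom of the recurrence are constants;
the recurrence, with each of its steps multiplied by 4, then runs on polynomials with
integer coefficients ([table_correct]). Across each of the five lines L = 0, the
polynomials of a spline change by L^4 times an affine function. Hence near e each spline
is a polynomial plus multiples of fourth powers of positive parts of affine functions
([strip_value]). This is a C^3 function on the whole plane, so the extension by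
continuity and all limits of derivatives of order at most 3 exist.

The C^r join therefore says that the difference of two C^3 functions has vanishing
partial derivatives of order at most r on e ([smooth_join_flat]). This property does not
depend on affine coordinates ([flat_comp]); in those of the second triangle the first
spline is composed with (x, y) -> (x + b2 y, b3 y) ([chart_shear]). By continuity the
midpoint and the ends of e may be left out ([flat_limit]), and since the tangential
derivatives follow from the others, only d^k/dy^k for k <= r have to vanish, on the two
halves of e ([flat_axis]). There both functions are polynomials. The basis elements
after the 25th vanish to order 3 on e and drop out ([in_Bc_cases]).

For each k the k-th y-derivative of the difference is, once the conditions of lower
order hold, a combination of fixed functions of x whose coefficients are the differences
of the two sides of the conditions of order k. The fixed functions are the k-th
y-derivatives of the basis elements that occur first in order k; they are linearly
independent ([traces_independent0], ..., [traces_independent3]), so all the conditions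
must hold ([C0_iff_gap], ..., [C3_iff_gap]). The k-th derivatives are C^(3-k) splines of
degree 5-k with one break, which form spaces of dimensions 8, 7, 6, 5. In order 3 there
are only four new basis elements; the fifth dimension, spanned by the function x^2 on
the first half and (2-x)^2 on the second one, is responsible for the condition in which
no coefficient of the second spline occurs. *)

(** * Functions of class C^n on the plane *)

Definition dx (f : point -> R) (p : point) : R :=
  Derive (fun t => f (t, snd p)) (fst p).
Definition dy (f : point -> R) (p : point) : R :=
  Derive (fun t => f (fst p, t)) (snd p).

(** Class C^n in a form made for induction: the two first partial derivatives are again
    of class C^(n-1). *)
Fixpoint smooth (n : nat) (f : point -> R) : Prop :=
  (forall p, continuous f p) /\
  match n with
  | O => True
  | S m =>
      (forall p, ex_derive (fun t => f (t, snd p)) (fst p)) /\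
      (forall p, ex_derive (fun t => f (fst p, t)) (snd p)) /\
      smooth m (dx f) /\ smooth m (dy f)
  end.

Lemma smooth_continuous n f p : smooth n f -> continuous f p.
Proof. destruct n; intros H; apply H. Qed.

Lemma smooth_S n f : smooth (S n) f -> smooth n f.
Proof.
  revert f; induction n as [|n IH]; intros f H; [split; [apply H | easy]|].
  destruct H as (H0 & Hx & Hy & Hdx & Hdy).
  repeat split; auto; apply IH; assumption.
Qed.

Lemma smooth_le m n f : (m <= n)%nat -> smooth n f -> smooth m f.
Proof. induction 1; auto using smooth_S. Qed.

Lemma dx_unique f fx :
  (forall p, is_derive (fun t => f (t, snd p)) (fst p) (fx p)) -> dx f = fx.
Proof.
  intros H; apply functional_extensionality; intros p.
  apply is_derive_unique, H.
Qed.

Lemma dy_unique f fy :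
  (forall p, is_derive (fun t => f (fst p, t)) (snd p) (fy p)) -> dy f = fy.
Proof.
  intros H; apply functional_extensionality; intros p.
  apply is_derive_unique, H.
Qed.

Lemma smooth_intro n f fx fy :
  (forall p, continuous f p) ->
  (forall p, is_derive (fun t => f (t, snd p)) (fst p) (fx p)) ->
  (forall p, is_derive (fun t => f (fst p, t)) (snd p) (fy p)) ->
  smooth n fx -> smooth n fy -> smooth (S n) f.
Proof.
  intros H0 Hx Hy Sx Sy; repeat split; auto.
  - intros p; eexists; apply Hx.
  - intros p; eexists; apply Hy.
  - now rewrite (dx_unique _ _ Hx).
  - now rewrite (dy_unique _ _ Hy).
Qed.

Lemma smooth_is_dx n f p :
  smooth (S n) f -> is_derive (fun t => f (t, snd p)) (fst p) (dx f p).
Proof. intros (_ & H & _); apply Derive_correct, H. Qed.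

Lemma smooth_is_dy n f p :
  smooth (S n) f -> is_derive (fun t => f (fst p, t)) (snd p) (dy f p).
Proof. intros (_ & _ & H & _); apply Derive_correct, H. Qed.

Lemma smooth_const n a : smooth n (fun _ => a).
Proof.
  revert a; induction n as [|n IH]; intros a.
  - split; [intros; apply continuous_const | easy].
  - apply smooth_intro with (fun _ => 0) (fun _ => 0); auto; intros p.
    + apply continuous_const.
    + apply is_derive_Reals, derivable_pt_lim_const.
    + apply is_derive_Reals, derivable_pt_lim_const.
Qed.

Lemma dx_plus f g :
  smooth 1 f -> smooth 1 g ->
  dx (fun p => f p + g p) = (fun p => dx f p + dx g p).
Proof.
  intros Hf Hg; apply dx_unique; intros p.
  now apply @is_derive_plus; apply smooth_is_dx with O.
Qed.

Lemma dy_plus f g :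
  smooth 1 f -> smooth 1 g ->
  dy (fun p => f p + g p) = (fun p => dy f p + dy g p).
Proof.
  intros Hf Hg; apply dy_unique; intros p.
  now apply @is_derive_plus; apply smooth_is_dy with O.
Qed.

Lemma smooth_1 n f : smooth (S n) f -> smooth 1 f.
Proof. apply smooth_le; lia. Qed.

Lemma smooth_plus n f g :
  smooth n f -> smooth n g -> smooth n (fun p => f p + g p).
Proof.
  revert f g; induction n as [|n IH]; intros f g Hf Hg.
  - split; [|easy]; intros p.
    apply @continuous_plus; [apply Hf | apply Hg].
  - apply smooth_intro with (fun p => dx f p + dx g p) (fun p => dy f p + dy g p).
    + intros p; apply @continuous_plus; [apply Hf | apply Hg].
    + intros p; now apply @is_derive_plus; apply smooth_is_dx with n.
    + intros p; now apply @is_derive_plus; apply smooth_is_dy with n.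
    + apply IH; [apply Hf | apply Hg].
    + apply IH; [apply Hf | apply Hg].
Qed.

Lemma smooth_mult n f g :
  smooth n f -> smooth n g -> smooth n (fun p => f p * g p).
Proof.
  revert f g; induction n as [|n IH]; intros f g Hf Hg.
  - split; [|easy]; intros p.
    apply @continuous_mult; [apply Hf | apply Hg].
  - assert (Hf' := smooth_S _ _ Hf). assert (Hg' := smooth_S _ _ Hg).
    apply smooth_intro with (fun p => dx f p * g p + f p * dx g p)
                            (fun p => dy f p * g p + f p * dy g p).
    + intros p; apply @continuous_mult; [apply Hf | apply Hg].
    + intros p. destruct p as [x y].
      apply (is_derive_mult (fun t => f (t, y)) (fun t => g (t, y)));
        [ now apply (smooth_is_dx n f (x, y))
        | now apply (smooth_is_dx n g (x, y)) | intros; apply Rmult_comm].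
    + intros p. destruct p as [x y].
      apply (is_derive_mult (fun t => f (x, t)) (fun t => g (x, t)));
        [ now apply (smooth_is_dy n f (x, y))
        | now apply (smooth_is_dy n g (x, y)) | intros; apply Rmult_comm].
    + apply smooth_plus; apply IH; auto; [apply Hf | apply Hg].
    + apply smooth_plus; apply IH; auto; [apply Hf | apply Hg].
Qed.

Lemma smooth_scal n a f : smooth n f -> smooth n (fun p => a * f p).
Proof. intros H; apply smooth_mult; auto using smooth_const. Qed.

Lemma dx_scal a f : smooth 1 f -> dx (fun p => a * f p) = (fun p => a * dx f p).
Proof.
  intros Hf; apply dx_unique; intros p.
  apply (is_derive_scal (fun t => f (t, snd p))); now apply smooth_is_dx with O.
Qed.

Lemma dy_scal a f : smooth 1 f -> dy (fun p => a * f p) = (fun p => a * dy f p).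
Proof.
  intros Hf; apply dy_unique; intros p.
  apply (is_derive_scal (fun t => f (fst p, t))); now apply smooth_is_dy with O.
Qed.

Definition affine (L : R * R * R) (p : point) : R :=
  let '(a, b, c) := L in a * fst p + b * snd p + c.

Lemma continuous_affine L p : continuous (affine L) p.
Proof.
  destruct L as [[a b] c]; unfold affine.
  apply @continuous_plus; [|apply continuous_const].
  apply @continuous_plus; (apply @continuous_mult; [apply continuous_const|]);
    [apply continuous_fst | apply continuous_snd].
Qed.

Lemma smooth_affine n L : smooth n (affine L).
Proof.
  destruct n; [split; auto using continuous_affine|].
  destruct L as [[a b] c].
  apply smooth_intro with (fun _ => a) (fun _ => b); auto using smooth_const, continuous_affine.
  - intros p; unfold affine; simpl; auto_derive; auto; ring.
  - intros p; unfold affine; simpl; auto_derive; auto; ring.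
Qed.

Definition affine_map (M N : R * R * R) (p : point) : point :=
  (affine M p, affine N p).

Lemma continuous_affine_map M N p : continuous (affine_map M N) p.
Proof.
  apply (continuous_comp_2 (affine M) (affine N) (fun x y => (x, y)));
    [apply continuous_affine | apply continuous_affine |].
  apply continuous_ext with (fun x : R * R => x); [now intros [] | apply continuous_id].
Qed.

(** Chain rule along a line.  Continuity of one partial derivative near the point makes
    the function differentiable there. *)
Lemma is_derive_curve f a1 a0 b1 b0 t :
  smooth 1 f ->
  is_derive (fun t => f (a1 * t + a0, b1 * t + b0)) t
    (a1 * dx f (a1 * t + a0, b1 * t + b0) + b1 * dy f (a1 * t + a0, b1 * t + b0)).
Proof.
  intros Hf.
  set (x := a1 * t + a0). set (y := b1 * t + b0).
  assert (Df : filterdiff (fun u : R * R => f (fst u, snd u)) (locally (x, y))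
     (fun u : R * R => plus (scal (fst u) (dx f (x, y))) (scal (snd u) (dy f (x, y))))).
  { apply (is_derive_filterdiff (fun x y => f (x, y)) x y (fun x y => dx f (x, y))).
    - apply filter_forall; intros [u v]. now apply (smooth_is_dx 0 f (u, v)).
    - now apply (smooth_is_dy 0 f (x, y)).
    - destruct Hf as (_ & _ & _ & H & _).
      apply continuous_ext with (dx f); [now intros [] | apply (smooth_continuous 0), H]. }
  assert (Dc : filterdiff (fun t : R => (a1 * t + a0, b1 * t + b0)) (locally t)
     (fun h : R => (scal h a1, scal h b1))).
  { apply (filterdiff_comp_2 (fun t : R => a1 * t + a0) (fun t => b1 * t + b0)
       (fun x y => (x, y)) (fun h : R => scal h a1) (fun h : R => scal h b1)
       (fun x y => (x, y))).
    - change (is_derive (fun t => a1 * t + a0) t a1).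
      auto_derive; auto; ring.
    - change (is_derive (fun t => b1 * t + b0) t b1).
      auto_derive; auto; ring.
    - apply filterdiff_ext with (fun u : R * R => u); [now intros []|].
      apply filterdiff_ext_lin with (fun u : R * R => u); [|now intros []].
      apply filterdiff_id. }
  unfold is_derive.
  apply filterdiff_ext_lin with
    (fun h : R => plus (scal (scal h a1) (dx f (x, y))) (scal (scal h b1) (dy f (x, y)))).
  - apply (filterdiff_comp' (fun t : R => (a1 * t + a0, b1 * t + b0))
             (fun u : R * R => f (fst u, snd u)) t
             (fun h : R => (scal h a1, scal h b1))
             (fun u : R * R => plus (scal (fst u) (dx f (x, y))) (scal (snd u) (dy f (x, y))))).
    + exact Dc.
    + exact Df.
  - intros h; unfold plus, scal; simpl; unfold mult; simpl; ring.
Qed.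

Section AffineChange.
Variables M N : R * R * R.

Lemma dx_comp f :
  smooth 1 f ->
  dx (fun p => f (affine_map M N p)) =
  (fun p => fst (fst M) * dx f (affine_map M N p)
            + fst (fst N) * dy f (affine_map M N p)).
Proof.
  intros Hf; apply dx_unique; intros [x y].
  destruct M as [[a b] c], N as [[a' b'] c'].
  unfold affine_map, affine; cbn [fst snd].
  rewrite !Rplus_assoc.
  apply is_derive_ext with (fun t => f (a * t + (b * y + c), a' * t + (b' * y + c'))).
  - intros t; now rewrite !Rplus_assoc.
  - now apply is_derive_curve.
Qed.

Lemma dy_comp f :
  smooth 1 f ->
  dy (fun p => f (affine_map M N p)) =
  (fun p => snd (fst M) * dx f (affine_map M N p)
            + snd (fst N) * dy f (affine_map M N p)).
Proof.
  intros Hf; apply dy_unique; intros [x y].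
  destruct M as [[a b] c], N as [[a' b'] c'].
  unfold affine_map, affine; cbn [fst snd].
  replace (a * x + b * y + c) with (b * y + (a * x + c)) by ring.
  replace (a' * x + b' * y + c') with (b' * y + (a' * x + c')) by ring.
  apply is_derive_ext with (fun t => f (b * t + (a * x + c), b' * t + (a' * x + c'))).
  - intros t; do 2 f_equal; ring.
  - now apply is_derive_curve.
Qed.

Lemma smooth_comp n f : smooth n f -> smooth n (fun p => f (affine_map M N p)).
Proof.
  assert (C : forall g : point -> R, (forall p, continuous g p) ->
     forall p, continuous (fun p => g (affine_map M N p)) p).
  { intros g Hg p.
    apply (@continuous_comp _ (prod_UniformSpace R_UniformSpace R_UniformSpace) _
             (affine_map M N) g p);
      [apply continuous_affine_map | apply Hg]. }
  revert f; induction n as [|n IH]; intros f Hf.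
  - split; [apply C, Hf | easy].
  - assert (H1 := smooth_1 _ _ Hf).
    assert (E : forall p, ex_derive (fun t => f (affine_map M N (t, snd p))) (fst p)
                /\ ex_derive (fun t => f (affine_map M N (fst p, t))) (snd p)).
    { intros [x y]; destruct M as [[a b] c], N as [[a' b'] c']; split; eexists;
      unfold affine_map, affine; cbn [fst snd].
      - apply is_derive_ext with (fun t => f (a * t + (b * y + c), a' * t + (b' * y + c'))).
        + intros t; now rewrite !Rplus_assoc.
        + now apply is_derive_curve.
      - apply is_derive_ext with (fun t => f (b * t + (a * x + c), b' * t + (a' * x + c'))).
        + intros t; do 2 f_equal; ring.
        + now apply is_derive_curve. }
    repeat split.
    + apply C, Hf.
    + intros p; apply E.
    + intros p; apply E.
    + rewrite dx_comp by assumption.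
      apply smooth_plus; apply smooth_scal, IH; apply Hf.
    + rewrite dy_comp by assumption.
      apply smooth_plus; apply smooth_scal, IH; apply Hf.
Qed.

End AffineChange.

(** The truncated power; its only singularity is at 0, where it is of class C^(n-1). *)
Definition tpow (n : nat) (t : R) : R := Rmax 0 t ^ n.

Lemma tpow_pos n t : 0 <= t -> tpow n t = t ^ n.
Proof. intros H; unfold tpow; now rewrite Rmax_right. Qed.

Lemma tpow_neg n t : t <= 0 -> tpow (S n) t = 0.
Proof. intros H; unfold tpow; rewrite Rmax_left by lra; simpl; ring. Qed.

Lemma continuous_tpow n t : continuous (tpow n) t.
Proof.
  apply (continuous_comp (Rmax 0) (fun u => u ^ n)).
  - apply continuous_ext with (fun t => (t + Rabs t) * / 2).
    { intros u; unfold Rmax, Rabs; destruct (Rle_dec 0 u), (Rcase_abs u); lra. }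
    apply @continuous_mult; [|apply continuous_const].
    apply @continuous_plus; [apply continuous_id | apply continuous_Rabs].
  - apply @ex_derive_continuous. auto_derive; auto.
Qed.

(** At 0 the difference quotient of the power with exponent n+2 is the power with exponent
    n+1, which is continuous and vanishes there. *)
Lemma is_derive_tpow n t :
  is_derive (tpow (S (S n))) t (INR (S (S n)) * tpow (S n) t).
Proof.
  destruct (Rtotal_order t 0) as [H | [-> | H]].
  - rewrite tpow_neg, Rmult_0_r by lra.
    apply is_derive_ext_loc with (fun _ => 0); [|apply @is_derive_const].
    apply (filter_imp (fun u => u < 0)).
    + intros u Hu; symmetry; apply tpow_neg; lra.
    + apply (locally_open (fun u => u < 0)); [apply open_lt | auto | assumption].
  - rewrite tpow_neg, Rmult_0_r by lra.
    apply is_derive_Reals; intros eps Heps.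
    destruct (proj1 (filterlim_locally _ _) (continuous_tpow (S n) 0) (mkposreal _ Heps))
      as [delta Hd].
    exists delta; intros h Hh Hlt.
    rewrite Rplus_0_l, (tpow_neg (S n) 0), !Rminus_0_r by lra.
    assert (Hb : Rabs (tpow (S n) h) < eps).
    { specialize (Hd h). unfold ball in Hd; simpl in Hd.
      unfold AbsRing_ball, abs, minus, plus, opp in Hd; simpl in Hd.
      rewrite (tpow_neg n 0), Ropp_0, !Rplus_0_r in Hd by lra. now apply Hd. }
    destruct (Rle_dec 0 h) as [Hpos | Hneg].
    + rewrite tpow_pos in * by assumption.
      replace (h ^ S (S n) / h) with (h ^ S n) by (simpl; field; assumption).
      assumption.
    + rewrite tpow_neg by lra. unfold Rdiv; rewrite Rmult_0_l, Rabs_R0; lra.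
  - rewrite tpow_pos by lra.
    apply is_derive_ext_loc with (fun u => u ^ S (S n)).
    + apply (filter_imp (fun u => 0 < u)).
      * intros u Hu; symmetry; apply tpow_pos; lra.
      * apply (locally_open (fun u => 0 < u)); [apply open_gt | auto | assumption].
    + auto_derive; auto. simpl; ring.
Qed.

Lemma smooth_tpow n L : smooth n (fun p => tpow (S n) (affine L p)).
Proof.
  assert (C : forall n p, continuous (fun p => tpow n (affine L p)) p).
  { intros m p; apply (continuous_comp (affine L) (tpow m));
    [apply continuous_affine | apply continuous_tpow]. }
  induction n as [|n IH]; [split; auto|].
  destruct L as [[a b] c].
  apply smooth_intro with
    (fun p => a * (INR (S (S n)) * tpow (S n) (affine (a, b, c) p)))
    (fun p => b * (INR (S (S n)) * tpow (S n) (affine (a, b, c) p))); auto.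
  - intros [x y]; unfold affine; cbn [fst snd].
    apply (is_derive_comp (tpow (S (S n))) (fun t => a * t + b * y + c)).
    + apply is_derive_tpow.
    + auto_derive; auto; ring.
  - intros [x y]; unfold affine; cbn [fst snd].
    apply (is_derive_comp (tpow (S (S n))) (fun t => a * x + b * t + c)).
    + apply is_derive_tpow.
    + auto_derive; auto; ring.
  - apply smooth_scal, smooth_scal, IH.
  - apply smooth_scal, smooth_scal, IH.
Qed.

(** * Vanishing of all partial derivatives, and smooth joins *)

(** All partial derivatives of [f] of order at most [r], in any sequence of the two
    variables, vanish at [p]; this form is stable under affine changes of variables. *)
Fixpoint flat (r : nat) (f : point -> R) (p : point) : Prop :=
  f p = 0 /\
  match r with
  | O => True
  | S r' => flat r' (dx f) p /\ flat r' (dy f) p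
  end.

Lemma flat_value r f p : flat r f p -> f p = 0.
Proof. destruct r; intros H; apply H. Qed.

Lemma flat_S r f p : flat (S r) f p -> flat r f p.
Proof.
  revert f; induction r as [|r IH]; intros f Hf; [split; [apply Hf | easy]|].
  destruct Hf as (H0 & Hx & Hy); repeat split; auto.
Qed.

Lemma flat_lin r a b f g p :
  smooth r f -> smooth r g -> flat r f p -> flat r g p ->
  flat r (fun q => a * f q + b * g q) p.
Proof.
  revert f g; induction r as [|r IH]; intros f g Sf Sg Hf Hg.
  - split; [|easy]. rewrite (flat_value _ _ _ Hf), (flat_value _ _ _ Hg); ring.
  - assert (Sf1 := smooth_1 _ _ Sf). assert (Sg1 := smooth_1 _ _ Sg).
    repeat split.
    + rewrite (flat_value _ _ _ Hf), (flat_value _ _ _ Hg); ring.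
    + rewrite (dx_plus (fun q => a * f q)), !dx_scal by auto using smooth_scal.
      apply IH; [apply Sf | apply Sg | apply Hf | apply Hg].
    + rewrite (dy_plus (fun q => a * f q)), !dy_scal by auto using smooth_scal.
      apply IH; [apply Sf | apply Sg | apply Hf | apply Hg].
Qed.

(** Each first derivative of the composition is a linear combination of first derivatives
    composed with the affine map. *)
Lemma flat_comp M N r f p :
  smooth r f -> flat r f (affine_map M N p) ->
  flat r (fun q => f (affine_map M N q)) p.
Proof.
  revert f; induction r as [|r IH]; intros f Sf Hf; [split; [apply Hf | easy]|].
  assert (Sf1 := smooth_1 _ _ Sf).
  repeat split.
  - apply Hf.
  - rewrite dx_comp by assumption.
    apply flat_lin; try (apply smooth_comp, Sf); apply IH; try apply Sf; apply Hf.
  - rewrite dy_comp by assumption.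
    apply flat_lin; try (apply smooth_comp, Sf); apply IH; try apply Sf; apply Hf.
Qed.

(** The derivatives are continuous, so a zero set of all of them is closed. *)
Lemma flat_limit r f p :
  smooth r f -> (forall P, locally p P -> exists q, P q /\ flat r f q) -> flat r f p.
Proof.
  revert f; induction r as [|r IH]; intros f Sf H.
  - split; [|easy].
    destruct (Req_dec (f p) 0) as [|Hne]; [assumption|exfalso].
    destruct (H (fun q => f q <> 0)) as (q & Hq & Hf).
    + apply (proj1 Sf p (fun y => y <> 0)).
      apply (locally_open (fun y => y <> 0)); [apply open_neq | auto | assumption].
    + apply Hq, Hf.
  - split; [|split].
    + apply (flat_value r), IH; [now apply smooth_S|].
      intros P HP; destruct (H P HP) as (q & Hq & Hf).
      exists q; split; [assumption | now apply flat_S].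
    + apply IH; [apply Sf|].
      intros P HP; destruct (H P HP) as (q & Hq & Hf).
      exists q; split; [assumption | apply Hf].
    + apply IH; [apply Sf|].
      intros P HP; destruct (H P HP) as (q & Hq & Hf).
      exists q; split; [assumption | apply Hf].
Qed.

Lemma locally_line_x (P : point -> Prop) p :
  locally p P -> locally (fst p) (fun t => P (t, snd p)).
Proof.
  intros [eps H]; exists eps; intros t Ht.
  apply H; split; [assumption | apply ball_center].
Qed.

Lemma locally_line_y (P : point -> Prop) p :
  locally p P -> locally (snd p) (fun t => P (fst p, t)).
Proof.
  intros [eps H]; exists eps; intros t Ht.
  apply H; split; [apply ball_center | assumption].
Qed.

Lemma dx_local f g p :
  locally p (fun q => f q = g q) -> locally p (fun q => dx f q = dx g q).
Proof.
  intros H; apply locally_locally in H; revert H; apply filter_imp; intros q Hq.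
  apply Derive_ext_loc, (locally_line_x _ _ Hq).
Qed.

Lemma dy_local f g p :
  locally p (fun q => f q = g q) -> locally p (fun q => dy f q = dy g q).
Proof.
  intros H; apply locally_locally in H; revert H; apply filter_imp; intros q Hq.
  apply Derive_ext_loc, (locally_line_y _ _ Hq).
Qed.

Definition partials (m k : nat) (f : point -> R) : point -> R :=
  Nat.iter m dx (Nat.iter k dy f).

(** [partial_derive m k] takes the [k] derivatives in the second variable first. *)
Lemma partial_derive_partials m k f p :
  partial_derive m k (fun x y => f (x, y)) (fst p) (snd p) = partials m k f p.
Proof.
  assert (Hy : forall x y, Derive_n (fun z => f (x, z)) k y = Nat.iter k dy f (x, y)).
  { intros x; induction k as [|k IH]; intros y; [reflexivity|].
    simpl. apply Derive_ext; intros t; apply IH. }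
  unfold partial_derive, partials; destruct p as [x y]; cbn [fst snd].
  revert x; induction m as [|m IH]; intros x; [apply Hy|].
  simpl; apply Derive_ext; intros t; apply IH.
Qed.

Lemma partials_local m k f g p :
  locally p (fun q => f q = g q) ->
  locally p (fun q => partials m k f q = partials m k g q).
Proof.
  intros H; unfold partials.
  assert (Hk : locally p (fun q => Nat.iter k dy f q = Nat.iter k dy g q)).
  { induction k as [|k IH]; [assumption | now apply dy_local]. }
  induction m as [|m IH]; [assumption | now apply dx_local].
Qed.

Lemma dx_dy f : smooth 2 f -> dx (dy f) = dy (dx f).
Proof.
  intros (_ & Hx & Hy & (_ & _ & Hxy & _ & Cxy) & (_ & Hyx & _ & Cyx & _)).
  apply functional_extensionality; intros [x y].
  apply (Schwarz (fun x y => f (x, y)) x y).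
  - exists (mkposreal 1 Rlt_0_1); intros u v _ _; repeat split.
    + apply (Hx (u, v)).
    + apply (Hy (u, v)).
    + apply (Hyx (u, v)).
    + apply (Hxy (u, v)).
  - apply continuity_2d_pt_filterlim, (smooth_continuous 0 _ (x, y) Cyx).
  - apply continuity_2d_pt_filterlim, (smooth_continuous 0 _ (x, y) Cxy).
Qed.

Lemma iter_dy_dx k f : smooth (S k) f -> Nat.iter k dy (dx f) = dx (Nat.iter k dy f).
Proof.
  revert f; induction k as [|k IH]; intros f Sf; [reflexivity|].
  rewrite !Nat.iter_succ_r, <- IH by apply Sf.
  f_equal; symmetry; apply dx_dy.
  apply smooth_le with (S (S k)); [lia | assumption].
Qed.

Lemma smooth_partials n m k f : smooth (m + k + n) f -> smooth n (partials m k f).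
Proof.
  unfold partials; revert m; induction k as [|k IH] in f |- *; intros m.
  - simpl. revert f; induction m as [|m IHm]; intros f Sf; [assumption|].
    rewrite Nat.iter_succ_r; apply IHm.
    replace (m + 0 + n)%nat with (m + n)%nat by lia.
    replace (S m + 0 + n)%nat with (S (m + n)) in Sf by lia; apply Sf.
  - intros Sf; rewrite Nat.iter_succ_r; apply IH.
    replace (m + S k + n)%nat with (S (m + k + n)) in Sf by lia; apply Sf.
Qed.

(** Mixed derivatives commute, so one sequence of the variables for each pair of orders
    is enough. *)
Lemma flat_partials r f p :
  smooth r f ->
  flat r f p <-> (forall m k, (m + k <= r)%nat -> partials m k f p = 0).
Proof.
  revert f; induction r as [|r IH]; intros f Sf.
  - split.
    + intros [H _] [|m] [|k] Hmk; try lia; assumption.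
    + intros H; split; [apply (H 0%nat 0%nat); lia | easy].
  - assert (X := IH (dx f) ltac:(apply Sf)). assert (Y := IH (dy f) ltac:(apply Sf)).
    split.
    + intros (H0 & Hx & Hy) m [|k] Hmk.
      * destruct m as [|m]; [assumption|].
        unfold partials; simpl (Nat.iter 0 dy f). rewrite Nat.iter_succ_r.
        apply (proj1 X Hx m 0%nat); lia.
      * unfold partials; rewrite Nat.iter_succ_r with (n := k).
        apply (proj1 Y Hy m k); lia.
    + intros H; repeat split; [apply (H 0%nat 0%nat); lia | apply X | apply Y];
        intros m k Hmk.
      * unfold partials; rewrite iter_dy_dx, <- Nat.iter_succ_r.
        -- apply (H (S m) k); lia.
        -- apply smooth_le with (S r); [lia | assumption].
      * unfold partials; rewrite <- Nat.iter_succ_r. apply (H m (S k)); lia.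
Qed.

(** A derivative that vanishes along the axis has a vanishing tangential derivative, so
    the derivatives in the transversal direction decide. *)
Lemma flat_axis r f (a b : R) :
  smooth r f ->
  (forall k x, (k <= r)%nat -> a < x < b -> Nat.iter k dy f (x, 0) = 0) ->
  forall x, a < x < b -> flat r f (x, 0).
Proof.
  revert f; induction r as [|r IH]; intros f Sf H x Hx.
  - split; [apply (H 0%nat); auto | easy].
  - repeat split.
    + apply (H 0%nat); [lia | assumption].
    + apply IH; [apply Sf | | assumption].
      intros k t Hk Ht.
      rewrite iter_dy_dx by (apply smooth_le with (S r); [lia | assumption]).
      unfold dx; cbn [fst snd].
      rewrite (Derive_ext_loc _ (fun _ => 0)); [apply Derive_const|].
      apply (filter_imp (fun u => a < u < b)).
      * intros u Hu; apply H; [lia | assumption].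
      * apply (locally_open (fun u => a < u < b)); [|auto | assumption].
        apply open_and; [apply open_gt | apply open_lt].
    + apply IH; [apply Sf | | assumption].
      intros k t Hk Ht; rewrite <- Nat.iter_succ_r. apply H; [lia | assumption].
Qed.

Lemma flat_iter_dy r f p k :
  flat r f p -> (k <= r)%nat -> Nat.iter k dy f p = 0.
Proof.
  revert f r; induction k as [|k IH]; intros f r H Hk; [now apply flat_value in H|].
  destruct r as [|r]; [lia|].
  rewrite Nat.iter_succ_r; apply IH with r; [apply H | lia].
Qed.

(** [p] is a limit of points of [A], so that limits at [p] within [A] are unique. *)
Definition adherent (A : point -> Prop) (p : point) : Prop :=
  forall P, locally p P -> exists z, A z /\ P z.

Lemma adherent_proper A p : adherent A p -> ProperFilter (within A (locally p)).
Proof.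
  intros H; constructor; [|apply within_filter, locally_filter].
  intros P HP; destruct (H _ HP) as (z & Az & Pz); exists z; now apply Pz.
Qed.

Lemma partial_from_unique (A : point -> Prop) (f : point -> R) m k (p : point) l l' :
  adherent (Defs.interior A) p ->
  partial_from A m k f p l -> partial_from A m k f p l' -> l = l'.
Proof.
  intros HA H H'; assert (PF := adherent_proper _ _ HA).
  exact (filterlim_locally_unique _ _ _ H H').
Qed.

Lemma partial_from_smooth (A : point -> Prop) (f F : point -> R) m k (p : point) :
  smooth (m + k) F -> locally p (fun z => A z -> f z = F z) ->
  partial_from A m k f p (partials m k F p).
Proof.
  intros SF H; unfold partial_from.
  apply filterlim_ext_loc with (partials m k F).
  - unfold within; apply locally_locally in H.
    revert H; apply filter_imp; intros z Hz Az.
    rewrite partial_derive_partials; symmetry.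
    apply (locally_singleton z (fun w => partials m k f w = partials m k F w)),
      partials_local.
    generalize (filter_and _ _ Az Hz); apply filter_imp; intros w [Aw Hw]; auto.
  - eapply filterlim_filter_le_1; [apply filter_le_within|].
    apply (smooth_continuous 0), smooth_partials.
    now rewrite Nat.add_0_r.
Qed.

(** The limits in the definition of a smooth join are the values of the derivatives of the
    C^r functions [F] and [G] that extend [f] and [g] across the edge. *)
Lemma smooth_join_flat r (e A A' : point -> Prop) (f g F G : point -> R) :
  (forall p, e p -> adherent (Defs.interior A) p) ->
  (forall p, e p -> adherent (Defs.interior A') p) ->
  (forall p, e p -> locally p (fun z => A z -> f z = F z)) ->
  (forall p, e p -> locally p (fun z => A' z -> g z = G z)) ->
  smooth r F -> smooth r G ->
  smooth_join r e A A' f g <-> (forall p, e p -> flat r (fun q => F q - G q) p).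
Proof.
  intros HA HA' Hf Hg SF SG.
  assert (E : (fun q => F q - G q) = (fun q => F q + (-1) * G q))
    by (apply functional_extensionality; intros q; ring).
  assert (Smis : smooth r (fun q => F q - G q))
    by (rewrite E; apply smooth_plus, smooth_scal; assumption).
  assert (PW : forall p m k, (m + k <= r)%nat ->
     partials m k (fun q => F q - G q) p = partials m k F p - partials m k G p).
  { rewrite E; intros p m k Hmk; unfold partials.
    assert (Y : forall k F G, smooth k F -> smooth k G ->
      Nat.iter k dy (fun q => F q + (-1) * G q)
      = fun q => Nat.iter k dy F q + (-1) * Nat.iter k dy G q).
    { clear; induction k as [|k IH]; intros F G SF SG; [reflexivity|].
      assert (SF1 := smooth_1 _ _ SF). assert (SG1 := smooth_1 _ _ SG).
      rewrite !Nat.iter_succ_r, dy_plus, dy_scal by auto using smooth_scal.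
      apply IH; [apply SF | apply SG]. }
    assert (X : forall m F G, smooth m F -> smooth m G ->
      Nat.iter m dx (fun q => F q + (-1) * G q)
      = fun q => Nat.iter m dx F q + (-1) * Nat.iter m dx G q).
    { clear; induction m as [|k IH]; intros F G SF SG; [reflexivity|].
      assert (SF1 := smooth_1 _ _ SF). assert (SG1 := smooth_1 _ _ SG).
      rewrite !Nat.iter_succ_r, dx_plus, dx_scal by auto using smooth_scal.
      apply IH; [apply SF | apply SG]. }
    rewrite Y, X.
    - ring.
    - apply (smooth_partials m 0 k). apply smooth_le with r; [lia | assumption].
    - apply (smooth_partials m 0 k). apply smooth_le with r; [lia | assumption].
    - apply smooth_le with r; [lia | assumption].
    - apply smooth_le with r; [lia | assumption]. }
  split.
  - intros J p ep; apply flat_partials; [assumption|].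
    intros m k Hmk; rewrite PW by assumption.
    destruct (J m k Hmk p ep) as (l & Hl & Hl').
    assert (El : partials m k F p = l).
    { apply (partial_from_unique A f m k p _ _ (HA p ep)); [|assumption].
      apply partial_from_smooth; [now apply smooth_le with r | auto]. }
    assert (El' : partials m k G p = l).
    { apply (partial_from_unique A' g m k p _ _ (HA' p ep)); [|assumption].
      apply partial_from_smooth; [now apply smooth_le with r | auto]. }
    rewrite El, El'; ring.
  - intros H m k Hmk p ep; exists (partials m k F p); split.
    + apply partial_from_smooth; [|now apply Hf].
      apply smooth_le with r; assumption.
    + assert (H0 := proj1 (flat_partials _ _ _ Smis) (H p ep) m k Hmk).
      rewrite PW in H0 by assumption.
      replace (partials m k F p) with (partials m k G p) by lra.
      apply partial_from_smooth; [|now apply Hg].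
      apply smooth_le with r; assumption.
Qed.

(** * Affine coordinates on the triangle *)

Lemma sum_1_10 (f : nat -> R) :
  sum_n_m f 1 10 = f 1%nat + f 2%nat + f 3%nat + f 4%nat + f 5%nat
                 + f 6%nat + f 7%nat + f 8%nat + f 9%nat + f 10%nat.
Proof.
  do 9 (rewrite sum_n_Sm by lia).
  rewrite sum_n_n; reflexivity.
Qed.

Lemma affine_map_midpoint M N a b :
  affine_map M N (midpoint a b) = midpoint (affine_map M N a) (affine_map M N b).
Proof.
  destruct M as [[m1 m2] m3], N as [[n1 n2] n3].
  unfold affine_map, midpoint, affine; simpl; f_equal; field.
Qed.

Lemma affine_map_vertex M N v1 v2 v3 j :
  affine_map M N (vertex v1 v2 v3 j)
  = vertex (affine_map M N v1) (affine_map M N v2) (affine_map M N v3) j.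
Proof.
  destruct j as [|[|[|[|[|[|[|[|[|[|j]]]]]]]]]]; unfold vertex;
  rewrite ?affine_map_midpoint; try reflexivity;
  destruct M as [[m1 m2] m3], N as [[n1 n2] n3];
  unfold affine_map, vertex, affine; simpl; f_equal; field.
Qed.

Lemma affine_map_det M N a b c :
  det (affine_map M N a) (affine_map M N b) (affine_map M N c)
  = (fst (fst M) * snd (fst N) - snd (fst M) * fst (fst N)) * det a b c.
Proof.
  destruct M as [[m1 m2] m3], N as [[n1 n2] n3].
  unfold det, affine_map, affine; simpl; ring.
Qed.

Section Invariance.
Variables (M N : R * R * R) (V : nat -> point).
Let V' j := affine_map M N (V j).

Lemma hull_affine_map K x : hull V K x -> hull V' K (affine_map M N x).
Proof.
  unfold V'; destruct M as [[m1 m2] m3], N as [[n1 n2] n3].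
  intros (b & Hb & Hz & H1 & Hx & Hy); exists b.
  rewrite !sum_1_10 in *; unfold affine_map, affine; cbn [fst snd].
  repeat split; auto;
  match goal with |- @eq _ ?a ?b => change (@eq R a b) end.
  - transitivity (m1 * fst x + m2 * snd x + m3 * 1); [|ring].
    rewrite <- Hx, <- Hy, <- H1; ring.
  - transitivity (n1 * fst x + n2 * snd x + n3 * 1); [|ring].
    rewrite <- Hx, <- Hy, <- H1; ring.
Qed.

Hypothesis MN : fst (fst M) * snd (fst N) - snd (fst M) * fst (fst N) <> 0.

Lemma find_triangle_affine_map K : find_triangle V' K = find_triangle V K.
Proof.
  unfold find_triangle; generalize (list_prod (support K) (list_prod (support K) (support K))).
  induction l as [|[i [j k]] l IH]; [reflexivity|]. simpl.
  destruct (Req_EM_T (det (V' i) (V' j) (V' k)) 0) as [E'|E'];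
  destruct (Req_EM_T (det (V i) (V j) (V k)) 0) as [E|E]; try (exact IH || reflexivity);
  exfalso; unfold V' in E'; rewrite affine_map_det in E'.
  - destruct (Rmult_integral _ _ E'); contradiction.
  - rewrite E in E'; lra.
Qed.

Lemma bary_coeff_affine_map i j k x l :
  det (V i) (V j) (V k) <> 0 ->
  bary_coeff V' i j k (affine_map M N x) l = bary_coeff V i j k x l.
Proof.
  intros H; unfold bary_coeff, V'; rewrite !affine_map_det.
  repeat destruct (_ =? _)%nat; try field; auto.
Qed.

Lemma find_triangle_det K i j k :
  find_triangle V K = Some (i, (j, k)) -> det (V i) (V j) (V k) <> 0.
Proof.
  intros H; apply find_some in H; simpl in H; destruct H as [_ H].
  now destruct (Req_EM_T _ 0).
Qed.

Hypothesis Hull : forall K x, hull V' K (affine_map M N x) -> hull V K x.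

(** The recurrence uses only ratios of determinants, collinearity and convex hulls. *)
Lemma Q_rec_affine_map n K x : Q_rec V' n K (affine_map M N x) = Q_rec V n K x.
Proof.
  revert K; induction n as [|n IH]; intros K; simpl; rewrite find_triangle_affine_map;
  destruct (find_triangle V K) as [[i [j k]]|] eqn:E; try reflexivity;
  apply find_triangle_det in E.
  - f_equal.
    + destruct (ClassicalEpsilon.excluded_middle_informative (hull V K x)) as [H|H];
      destruct (ClassicalEpsilon.excluded_middle_informative _) as [H'|H']; try reflexivity.
      * now apply hull_affine_map in H.
      * now apply Hull in H'.
    + unfold triangle_area, V'; rewrite !affine_map_det, !Rabs_mult. field.
      split; apply Rabs_no_R0; assumption.
  - apply sum_n_m_ext; intros l. now rewrite bary_coeff_affine_map, IH.
Qed.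
End Invariance.

Definition ref : nat -> point := vertex (0, 0) (2, 0) (0, 2).

Definition in_ref (q : point) : Prop := 0 <= fst q /\ 0 <= snd q /\ fst q + snd q <= 2.
Definition in_ref_interior (q : point) : Prop := 0 < fst q /\ 0 < snd q /\ fst q + snd q < 2.

Lemma hull_ref_whole q : hull ref whole_triangle q <-> in_ref q.
Proof.
  unfold in_ref; split.
  - intros (b & Hb & Hz & H1 & Hx & Hy); rewrite sum_1_10 in *; simpl in *.
    rewrite !(Hz 4%nat), !(Hz 5%nat), !(Hz 6%nat), !(Hz 7%nat), !(Hz 8%nat),
      !(Hz 9%nat), !(Hz 10%nat) in * by reflexivity.
    assert (A := Hb 1%nat); assert (B := Hb 2%nat); assert (C := Hb 3%nat); lra.
  - intros (Hx & Hy & Hs).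
    exists (fun j => match j with 1%nat => 1 - fst q / 2 - snd q / 2
                       | 2%nat => fst q / 2 | 3%nat => snd q / 2 | _ => 0 end).
    rewrite !sum_1_10; simpl; repeat split; try lra.
    + intros [|[|[|[|j]]]]; lra.
    + now intros [|[|[|[|j]]]].
Qed.

Lemma hull_ref_edge q : hull ref edge12 q <-> 0 <= fst q <= 2 /\ snd q = 0.
Proof.
  split.
  - intros (b & Hb & Hz & H1 & Hx & Hy); rewrite sum_1_10 in *; simpl in *.
    rewrite !(Hz 3%nat), !(Hz 4%nat), !(Hz 5%nat), !(Hz 6%nat), !(Hz 7%nat), !(Hz 8%nat),
      !(Hz 9%nat), !(Hz 10%nat) in * by reflexivity.
    assert (A := Hb 1%nat); assert (B := Hb 2%nat); lra.
  - intros (Hx & Hy).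
    exists (fun j => match j with 1%nat => 1 - fst q / 2 | 2%nat => fst q / 2
                       | _ => 0 end).
    rewrite !sum_1_10; simpl; repeat split; try lra.
    + intros [|[|[|j]]]; lra.
    + now intros [|[|[|j]]].
Qed.

Section Chart.
Variables v1 v2 v3 : point.
Hypothesis D0 : det v1 v2 v3 <> 0.
Let V := vertex v1 v2 v3.

Definition chartX : R * R * R :=
  (2 * (snd v3 - snd v1) / det v1 v2 v3, - 2 * (fst v3 - fst v1) / det v1 v2 v3,
   2 * ((fst v3 - fst v1) * snd v1 - fst v1 * (snd v3 - snd v1)) / det v1 v2 v3).
Definition chartY : R * R * R :=
  (- 2 * (snd v2 - snd v1) / det v1 v2 v3, 2 * (fst v2 - fst v1) / det v1 v2 v3,
   2 * (fst v1 * (snd v2 - snd v1) - (fst v2 - fst v1) * snd v1) / det v1 v2 v3).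
(** The affine coordinates for which [v1], [v2], [v3] are (0,0), (2,0), (0,2): a multiple of
    2 makes the midpoints integral. *)
Definition chart : point -> point := affine_map chartX chartY.

Definition unchartX : R * R * R :=
  ((fst v2 - fst v1) / 2, (fst v3 - fst v1) / 2, fst v1).
Definition unchartY : R * R * R :=
  ((snd v2 - snd v1) / 2, (snd v3 - snd v1) / 2, snd v1).
Definition unchart : point -> point := affine_map unchartX unchartY.

Lemma unchart_chart p : unchart (chart p) = p.
Proof.
  destruct p as [x y]; unfold unchart, chart, affine_map, affine.
  unfold chartX, chartY, unchartX, unchartY, det in *.
  destruct v1, v2, v3; simpl in *; f_equal; field; assumption.
Qed.

Lemma chart_unchart q : chart (unchart q) = q.
Proof.
  destruct q as [x y]; unfold unchart, chart, affine_map, affine.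
  unfold chartX, chartY, unchartX, unchartY, det in *.
  destruct v1, v2, v3; simpl in *; f_equal; field; assumption.
Qed.

Lemma unchart_ref j : unchart (ref j) = V j.
Proof.
  unfold unchart, ref; rewrite affine_map_vertex; unfold V; f_equal;
  unfold affine_map, affine, unchartX, unchartY; destruct v1, v2, v3; simpl; f_equal; field.
Qed.

Lemma chart_vertex j : chart (V j) = ref j.
Proof. now rewrite <- unchart_ref, chart_unchart. Qed.

Lemma hull_chart K x : hull V K x <-> hull ref K (chart x).
Proof.
  assert (E : ref = fun j => chart (V j))
    by (apply functional_extensionality; intros; now rewrite chart_vertex).
  assert (E' : V = fun j => unchart (ref j))
    by (apply functional_extensionality; intros; now rewrite unchart_ref).
  split; intros H.
  - rewrite E; exact (hull_affine_map chartX chartY V K x H).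
  - rewrite E', <- (unchart_chart x).
    exact (hull_affine_map unchartX unchartY ref K _ H).
Qed.

Lemma unchart_nonsingular :
  fst (fst unchartX) * snd (fst unchartY) - snd (fst unchartX) * fst (fst unchartY) <> 0.
Proof.
  replace (_ - _) with (det v1 v2 v3 / 4); [lra|].
  unfold det, unchartX, unchartY; simpl; field.
Qed.

Lemma Q_generic_chart K x : Q_generic V K x = Q_generic ref K (chart x).
Proof.
  unfold Q_generic.
  rewrite <- (unchart_chart x) at 1.
  replace V with (fun j => unchart (ref j))
    by (apply functional_extensionality; intros; now rewrite unchart_ref).
  apply Q_rec_affine_map.
  - exact unchart_nonsingular.
  - intros K' q H. apply (hull_affine_map chartX chartY) in H; fold chart unchart in H.
    rewrite chart_unchart in H; revert H.
    replace (fun j => chart (unchart (ref j))) with ref; [easy|].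
    apply functional_extensionality; intros; now rewrite chart_unchart.
Qed.

Lemma generic_chart x : generic V x <-> generic ref (chart x).
Proof.
  assert (E : forall i j, det (V i) (V j) x
     = det v1 v2 v3 / 4 * det (ref i) (ref j) (chart x)).
  { intros i j. rewrite <- (unchart_chart x) at 1.
    rewrite <- (unchart_ref i), <- (unchart_ref j).
    unfold unchart; rewrite affine_map_det; f_equal.
    unfold det, unchartX, unchartY; simpl; field. }
  split; intros H i j Hi Hj Hk E0; apply (H i j Hi Hj Hk).
  - rewrite E, E0; ring.
  - rewrite E in E0; destruct (Rmult_integral _ _ E0); [lra | assumption].
Qed.

End Chart.

(** Any other point of the triangle on none of the 45 lines would do. *)
Lemma generic_center : generic ref (7/10, 4/10).
Proof.
  intros i j Hi Hj Hk.
  do 11 (destruct i as [|i]; [try lia;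
    do 11 (destruct j as [|j]; [try lia; unfold det, ref, vertex, midpoint; simpl; lra|]);
    lia|]);
  lia.
Qed.

(** Move from [q] straight to a generic interior point: on the segment each of the 45
    determinants is an affine function that is nonzero at the far end, hence nonzero close
    to, but different from, [q]. *)
Lemma in_ref_adherent q :
  in_ref q -> adherent (fun z => in_ref_interior z /\ generic ref z) q.
Proof.
  intros Hq P HP.
  pose (z := fun e : R => ((7/10 - fst q) * e + fst q, (4/10 - snd q) * e + snd q) : point).
  assert (Hz : at_right 0 (fun e => P (z e))).
  { apply filter_le_within.
    assert (C : continuous z 0).
    { apply (continuous_comp_2 (fun e => (7/10 - fst q) * e + fst q)
        (fun e => (4/10 - snd q) * e + snd q) (fun x y => (x, y)));
      try (apply @ex_derive_continuous; auto_derive; auto).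
      apply continuous_ext with (fun x : R * R => x); [now intros [] | apply continuous_id]. }
    apply C. unfold z; rewrite !Rmult_0_r, !Rplus_0_l. now destruct q. }
  assert (H1 : at_right 0 (fun e => 0 < e < 1)).
  { exists (mkposreal 1 Rlt_0_1); intros e He Hp.
    unfold ball in He; simpl in He.
    unfold AbsRing_ball, abs, minus, plus, opp in He; simpl in He.
    apply Rabs_lt_between in He; lra. }
  assert (G : forall i j, (1 <= i)%nat -> (i < j)%nat -> (j <= 10)%nat ->
     at_right 0 (fun e => det (ref i) (ref j) (z e) <> 0)).
  { intros i j Hi Hj Hk. assert (Hc := generic_center i j Hi Hj Hk).
    set (A := det (ref i) (ref j) q). set (B := det (ref i) (ref j) (7/10, 4/10)) in Hc.
    assert (E : forall e, det (ref i) (ref j) (z e) = A + e * (B - A))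
      by (intros e; unfold A, B, det, z; simpl; ring).
    destruct (Req_dec A 0) as [HA|HA].
    - revert H1; apply filter_imp; intros e He. rewrite E, HA.
      intros H0; assert (H : e * B = 0) by lra.
      destruct (Rmult_integral _ _ H); lra.
    - apply filter_le_within.
      assert (C : continuous (fun e => det (ref i) (ref j) (z e)) 0).
      { apply continuous_ext with (fun e => A + e * (B - A)); [now intros; rewrite E|].
        apply @ex_derive_continuous; auto_derive; auto. }
      apply (C (fun y => y <> 0)), (locally_open (fun y => y <> 0));
        [apply open_neq | auto | rewrite E; lra]. }
  assert (GG : forall n, at_right 0 (fun e => forall i j, (i < n)%nat ->
      (1 <= i)%nat -> (i < j)%nat -> (j <= 10)%nat -> det (ref i) (ref j) (z e) <> 0)).
  { induction n as [|n IH]; [apply filter_forall; intros; lia|].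
    assert (Hn : forall m, at_right 0 (fun e => forall j, (j < m)%nat ->
      (1 <= n)%nat -> (n < j)%nat -> (j <= 10)%nat -> det (ref n) (ref j) (z e) <> 0)).
    { induction m as [|m IHm]; [apply filter_forall; intros; lia|].
      destruct (le_dec 1 n); [|apply filter_forall; intros; lia].
      destruct (lt_dec n m); [|revert IHm; apply filter_imp; intros e He j Hj ? ? ?;
        apply He; lia].
      destruct (le_dec m 10); [|revert IHm; apply filter_imp; intros e He j Hj ? ? ?;
        apply He; lia].
      generalize (filter_and _ _ IHm (G n m ltac:(lia) ltac:(lia) ltac:(lia))).
      apply filter_imp; intros e [Ha Hb] j Hj ? ? ?.
      destruct (Nat.eq_dec j m) as [->|]; [assumption | apply Ha; lia]. }
    generalize (filter_and _ _ IH (Hn 11%nat)); apply filter_imp; intros e [Ha Hb] i j ? ? ? ?.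
    destruct (Nat.eq_dec i n) as [->|]; [apply Hb; lia | apply Ha; lia]. }
  destruct (filter_ex _ (filter_and _ _ (filter_and _ _ Hz H1) (GG 11%nat)))
    as (e & [Pe He] & Ge).
  exists (z e); split; [|assumption]; split.
  - destruct Hq as (Hx & Hy & Hs); unfold in_ref_interior, z; simpl.
    assert (0 <= (1 - e) * fst q) by (apply Rmult_le_pos; lra).
    assert (0 <= (1 - e) * snd q) by (apply Rmult_le_pos; lra).
    assert (0 <= (1 - e) * (2 - (fst q + snd q))) by (apply Rmult_le_pos; lra).
    repeat split; lra.
  - intros i j Hi Hj Hk; apply Ge; lia.
Qed.

Section Chart2.
Variables v1 v2 v3 : point.
Hypothesis D0 : det v1 v2 v3 <> 0.
Let V := vertex v1 v2 v3.

Lemma whole_adherent x :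
  hull V whole_triangle x ->
  adherent (fun z => in_ref_interior (chart v1 v2 v3 z) /\ generic V z) x.
Proof.
  intros Hx P HP.
  apply hull_chart in Hx; [|assumption]; apply hull_ref_whole in Hx.
  destruct (in_ref_adherent _ Hx (fun q => P (unchart v1 v2 v3 q))) as (q & [Hq Gq] & Pq).
  - apply (continuous_affine_map (unchartX v1 v2 v3) (unchartY v1 v2 v3)).
    fold (unchart v1 v2 v3). now rewrite unchart_chart.
  - exists (unchart v1 v2 v3 q); split; [|assumption].
    rewrite chart_unchart by assumption; split; [assumption|].
    apply generic_chart; [assumption|]. now rewrite chart_unchart.
Qed.

Lemma in_ref_interior_open : open (in_ref_interior : R * R -> Prop).
Proof.
  unfold in_ref_interior; apply open_and; [|apply open_and].
  - apply (open_comp fst (fun x => 0 < x)); [intros; apply continuous_fst | apply open_gt].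
  - apply (open_comp snd (fun x => 0 < x)); [intros; apply continuous_snd | apply open_gt].
  - apply (open_comp (fun q : R * R => fst q + snd q) (fun x => x < 2)); [|apply open_lt].
    intros q _; apply @continuous_plus; [apply continuous_fst | apply continuous_snd].
Qed.

Lemma interior_adherent x :
  hull V whole_triangle x -> adherent (Defs.interior (hull V whole_triangle)) x.
Proof.
  intros Hx P HP; destruct (whole_adherent x Hx P HP) as (z & [Hz _] & Pz).
  exists z; split; [|assumption].
  unfold Defs.interior; apply (filter_imp (fun w => in_ref_interior (chart v1 v2 v3 w))).
  - intros w (Ha & Hb & Hc); apply hull_chart; [assumption|]; apply hull_ref_whole.
    unfold in_ref; repeat split; lra.
  - apply (continuous_affine_map (chartX v1 v2 v3) (chartY v1 v2 v3) z in_ref_interior).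
    apply locally_open with (in_ref_interior : R * R -> Prop); auto using in_ref_interior_open.
Qed.

(** The value by continuous extension is the value of any continuous function that agrees
    with the recurrence at the generic points nearby, because these accumulate at [x]. *)
Lemma Q_value K E x :
  (forall q, continuous E q) ->
  (forall q, in_ref q -> snd q < 1/2 -> generic ref q -> Q_generic ref K q = E q) ->
  hull V whole_triangle x -> snd (chart v1 v2 v3 x) < 1/2 ->
  Q V K x = E (chart v1 v2 v3 x).
Proof.
  intros CE HE Hx Sx.
  set (D := fun z => hull V whole_triangle z /\ generic V z).
  assert (PF : ProperFilter (within D (locally x))).
  { apply adherent_proper; intros P HP.
    destruct (whole_adherent x Hx P HP) as (z & [(Ha & Hb & Hc) Gz] & Pz).
    exists z; repeat split; auto. apply hull_chart; [assumption|]; apply hull_ref_whole.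
    unfold in_ref; repeat split; lra. }
  assert (L : filterlim (Q_generic V K) (within D (locally x))
                (locally (E (chart v1 v2 v3 x)))).
  { apply filterlim_ext_loc with (fun z => E (chart v1 v2 v3 z)).
    - unfold within; apply (filter_imp (fun z => snd (chart v1 v2 v3 z) < 1/2)).
      + intros z Sz [Hz Gz]. unfold V; rewrite Q_generic_chart by assumption.
        symmetry; apply HE; auto.
        * apply hull_ref_whole, (proj1 (hull_chart v1 v2 v3 D0 _ _)); assumption.
        * now apply (generic_chart v1 v2 v3 D0).
      + apply (continuous_affine (chartY v1 v2 v3) x (fun y => y < 1/2)).
        apply (locally_open (fun y => y < 1/2)); [apply open_lt | auto | assumption].
    - eapply filterlim_filter_le_1; [apply filter_le_within|].
      apply (@continuous_comp _ (prod_UniformSpace R_UniformSpace R_UniformSpace) _ (chart v1 v2 v3) E x);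
      [apply continuous_affine_map | apply CE]. }
  unfold Q; apply (@iota_unique R_AbsRing R_CompleteNormedModule); [|exact L].
  intros y Hy; exact (filterlim_locally_unique _ _ _ Hy L).
Qed.
End Chart2.

(** * The recurrence on integer polynomials *)

(** Sums over an abstract group give equations whose type [ring] and [field] do not
    recognize as [R]. *)
Ltac in_R := match goal with |- @eq _ ?a ?b => change (@eq R a b) end.

Definition upoly : Type := list Z.
(** The list of the coefficients of 1, y, y^2, ..., each of which is the list of the
    coefficients of a polynomial in x. *)
Definition poly : Type := list upoly.

Definition ueval (q : upoly) (x : R) : R := fold_right (fun a s => IZR a + x * s) 0 q.
Definition peval (p : poly) (z : point) : R :=
  fold_right (fun q s => ueval q (fst z) + snd z * s) 0 p.

Fixpoint zip {A : Type} (op : A -> A -> A) (l m : list A) : list A :=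
  match l, m with
  | [], _ => m
  | _, [] => l
  | a :: l', b :: m' => op a b :: zip op l' m'
  end.

Definition padd : poly -> poly -> poly := zip (zip Z.add).
Definition pscale (a : Z) : poly -> poly := map (map (Z.mul a)).
Definition pmulX : poly -> poly := map (cons 0%Z).
Definition pmulY : poly -> poly := cons [].

(** [(a, b, c)] stands for the affine function a x + b y + c. *)
Definition form : Type := (Z * Z * Z)%type.
Definition real_form (l : form) : R * R * R :=
  let '(a, b, c) := l in (IZR a, IZR b, IZR c).
Definition pmul_form (l : form) (p : poly) : poly :=
  let '(a, b, c) := l in
  padd (pscale a (pmulX p)) (padd (pscale b (pmulY p)) (pscale c p)).

Lemma ueval_cons a q x : ueval (a :: q) x = IZR a + x * ueval q x.
Proof. reflexivity. Qed.

Lemma peval_cons q p z : peval (q :: p) z = ueval q (fst z) + snd z * peval p z.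
Proof. reflexivity. Qed.

Lemma ueval_add p q x : ueval (zip Z.add p q) x = ueval p x + ueval q x.
Proof.
  revert q; induction p as [|a p IH]; intros [|b q]; cbn [zip];
    try (change (ueval [] x) with 0; ring).
  rewrite !ueval_cons, IH, plus_IZR; ring.
Qed.

Lemma peval_add p q z : peval (padd p q) z = peval p z + peval q z.
Proof.
  unfold padd; revert q; induction p as [|a p IH]; intros [|b q]; cbn [zip];
    try (change (peval [] z) with 0; ring).
  rewrite !peval_cons, IH, ueval_add; ring.
Qed.

Lemma ueval_scale a q x : ueval (map (Z.mul a) q) x = IZR a * ueval q x.
Proof.
  induction q as [|b q IH]; cbn [map]; [change (ueval [] x) with 0; ring|].
  rewrite !ueval_cons, IH, mult_IZR; ring.
Qed.

Lemma peval_scale a p z : peval (pscale a p) z = IZR a * peval p z.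
Proof.
  unfold pscale; induction p as [|q p IH]; cbn [map];
    [change (peval [] z) with 0; ring|].
  rewrite !peval_cons, IH, ueval_scale; ring.
Qed.

Lemma peval_mulX p z : peval (pmulX p) z = fst z * peval p z.
Proof.
  unfold pmulX; induction p as [|q p IH]; cbn [map];
    [change (peval [] z) with 0; ring|].
  rewrite !peval_cons, IH, ueval_cons; ring.
Qed.

Lemma peval_mulY p z : peval (pmulY p) z = snd z * peval p z.
Proof. unfold pmulY; rewrite peval_cons; simpl; ring. Qed.

Lemma peval_mul_form l p z : peval (pmul_form l p) z = affine (real_form l) z * peval p z.
Proof.
  destruct l as [[a b] c]; unfold pmul_form.
  rewrite !peval_add, !peval_scale, peval_mulX, peval_mulY; simpl; ring.
Qed.

Definition refZ (j : nat) : Z * Z :=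
  match j with
  | 2%nat => (2, 0) | 3%nat => (0, 2)
  | 4%nat => (1, 0) | 5%nat => (1, 1) | 6%nat => (0, 1)
  | _ => (0, 0)
  end%Z.

Definition label (j : nat) : Prop := (1 <= j <= 6)%nat.

Lemma ref_refZ j : label j -> ref j = (IZR (fst (refZ j)), IZR (snd (refZ j))).
Proof.
  intros [H1 H6].
  do 7 (destruct j as [|j]; [try lia; unfold ref, vertex, midpoint; simpl; f_equal; lra|]).
  lia.
Qed.

Definition detZ (a b c : Z * Z) : Z :=
  ((fst b - fst a) * (snd c - snd a) - (fst c - fst a) * (snd b - snd a))%Z.

(** The determinant of v_i, v_j and a variable point. *)
Definition side_form (i j : nat) : form :=
  let a := refZ i in let b := refZ j in
  (snd a - snd b, fst b - fst a, fst a * snd b - fst b * snd a)%Z.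

Lemma det_ref i j k :
  label i -> label j -> label k ->
  det (ref i) (ref j) (ref k) = IZR (detZ (refZ i) (refZ j) (refZ k)).
Proof.
  intros Hi Hj Hk; rewrite !ref_refZ by assumption; unfold det, detZ; simpl.
  now rewrite minus_IZR, !mult_IZR, !minus_IZR.
Qed.

Lemma det_side_form i j z :
  label i -> label j ->
  det (ref i) (ref j) z = affine (real_form (side_form i j)) z.
Proof.
  intros Hi Hj; rewrite !ref_refZ by assumption; unfold det, side_form, affine, real_form; simpl.
  rewrite !minus_IZR, !mult_IZR; ring.
Qed.

Definition find_triangleZ (K : multiset) : option (nat * (nat * nat)) :=
  find (fun t => negb (detZ (refZ (fst t)) (refZ (fst (snd t)))
                            (refZ (snd (snd t))) =? 0)%Z)
    (list_prod (support K) (list_prod (support K) (support K))).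

(** The knots are among v1, ..., v6; the other four vertices have no integer coordinates. *)
Definition few_labels (K : multiset) : bool := forallb (fun j => j <=? 6)%nat (support K).

Lemma support_label K j : few_labels K = true -> In j (support K) -> label j.
Proof.
  intros H Hj. assert (H' := proj1 (forallb_forall _ _) H j Hj).
  apply Nat.leb_le in H'. apply filter_In in Hj; destruct Hj as [Hj _].
  apply in_seq in Hj; unfold label; lia.
Qed.

Lemma find_triangle_ref K :
  few_labels K = true -> find_triangle ref K = find_triangleZ K.
Proof.
  intros H; unfold find_triangle, find_triangleZ.
  assert (L : forall t, In t (list_prod (support K) (list_prod (support K) (support K))) ->
     label (fst t) /\ label (fst (snd t)) /\ label (snd (snd t))).
  { intros [i [j k]] Ht; apply in_prod_iff in Ht; destruct Ht as [Hi Ht].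
    apply in_prod_iff in Ht; destruct Ht as [Hj Hk].
    repeat split; eapply support_label; eassumption. }
  revert L; induction (list_prod (support K) (list_prod (support K) (support K)))
    as [|[i [j k]] l IH]; intros L; [reflexivity|].
  assert (Hl := L _ (or_introl eq_refl)); simpl in Hl; destruct Hl as (Hi & Hj & Hk).
  simpl; rewrite IH by (intros t Ht; apply L; now right).
  destruct (Req_EM_T (det (ref i) (ref j) (ref k)) 0) as [E|E];
  destruct (Z.eqb_spec (detZ (refZ i) (refZ j) (refZ k)) 0) as [E'|E'];
  try reflexivity; rewrite det_ref in E by assumption.
  - now apply eq_IZR_R0 in E.
  - now rewrite E' in E.
Qed.

Lemma find_triangleZ_support K i j k :
  few_labels K = true -> find_triangleZ K = Some (i, (j, k)) ->
  (label i /\ label j /\ label k) /\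
  (In i (support K) /\ In j (support K) /\ In k (support K)) /\
  detZ (refZ i) (refZ j) (refZ k) <> 0%Z.
Proof.
  intros F H; apply find_some in H; destruct H as [H D]; simpl in D.
  apply in_prod_iff in H; destruct H as [Hi H]; apply in_prod_iff in H; destruct H as [Hj Hk].
  repeat split; auto; try (eapply support_label; eassumption).
  intros E; now rewrite E in D.
Qed.

Lemma detZ_distinct i j k :
  detZ (refZ i) (refZ j) (refZ k) <> 0%Z -> i <> j /\ i <> k /\ j <> k.
Proof. unfold detZ; repeat split; intros ->; lia. Qed.

Lemma sum_at i (a : R) :
  (1 <= i <= 10)%nat -> sum_n_m (fun l => if (l =? i)%nat then a else 0) 1 10 = a.
Proof.
  intros H; rewrite sum_1_10.
  in_R.
  do 11 (destruct i as [|i]; [try lia; simpl; ring|]); lia.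
Qed.

Lemma sum_three (f : nat -> R) i j k :
  label i -> label j -> label k -> i <> j -> i <> k -> j <> k ->
  (forall l, l <> i -> l <> j -> l <> k -> f l = 0) ->
  sum_n_m f 1 10 = f i + f j + f k.
Proof.
  unfold label; intros Hi Hj Hk ij ik jk H.
  rewrite (sum_n_m_ext f (fun l => plus (plus (if (l =? i)%nat then f i else 0)
    (if (l =? j)%nat then f j else 0)) (if (l =? k)%nat then f k else 0))).
  - rewrite !(sum_n_m_plus (G := R_AbelianGroup)), !sum_at by lia; reflexivity.
  - intros l; unfold plus; simpl.
    destruct (Nat.eqb_spec l i), (Nat.eqb_spec l j), (Nat.eqb_spec l k);
      subst; try lia; try ring. rewrite H by assumption; ring.
Qed.

(** The sample point is given in homogeneous coordinates, so that it may have denominators. *)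
Definition side_at (i j : nat) (s : Z * Z * Z) : Z :=
  let '(a, b, c) := side_form i j in let '(x, y, w) := s in (a * x + b * y + c * w)%Z.

(** [z] lies in the same cell as the sample [s] of the arrangement of all lines through two
    of v1, ..., v6. *)
Definition same_side (s : Z * Z * Z) (z : point) : Prop :=
  forall i j, label i -> label j -> i <> j ->
    0 < IZR (side_at i j s) * det (ref i) (ref j) z.

(** The areas of the triangles with vertices among v1, ..., v6 are 1, 1/2 or 1/4 of the area
    of the whole, so every step of the recurrence becomes integral when multiplied by 4. *)
Definition represents (s : Z * Z * Z) (n : nat) (e : multiset * poly) : Prop :=
  forall z, same_side s z -> 4 ^ n * Q_rec ref n (fst e) z = peval (snd e) z.

(** At the bottom of the recurrence the spline is an indicator function, which the signs at
    the sample decide; the area ratio is 4 over the determinant [d]. *)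
Definition leaf (s : Z * Z * Z) (K : multiset) : option poly :=
  if few_labels K then
    match find_triangleZ K with
    | None => Some []
    | Some (i, (j, k)) =>
        let d := detZ (refZ i) (refZ j) (refZ k) in
        let m := (4 / d)%Z in
        if (m * d =? 4)%Z
           && forallb (fun l => (Defs.mult K l =? 0) || (l =? i) || (l =? j) || (l =? k))%nat
                (seq 1 10)
        then
          if (0 <? d * side_at j k s)%Z && (0 <? d * side_at k i s)%Z
             && (0 <? d * side_at i j s)%Z
          then Some [[Z.abs m]] else Some []
        else None
    end
  else None.

Lemma det_cycle a b c : det a b c = det b c a.
Proof. unfold det; ring. Qed.

Lemma barycentric_det a b c x u v w :
  u + v + w = 1 ->
  u * fst a + v * fst b + w * fst c = fst x ->
  u * snd a + v * snd b + w * snd c = snd x ->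
  det b c x = u * det a b c /\ det c a x = v * det a b c /\ det a b x = w * det a b c.
Proof.
  intros H Hx Hy; unfold det; rewrite <- Hx, <- Hy.
  replace u with (1 - v - w) by lra; repeat split; ring.
Qed.

(** The weights of a convex combination of three affinely independent points are
    unique. *)
Lemma hull_triangle K i j k z :
  label i -> label j -> label k -> det (ref i) (ref j) (ref k) <> 0 ->
  i <> j -> i <> k -> j <> k ->
  In i (support K) -> In j (support K) -> In k (support K) ->
  (forall l, (1 <= l <= 10)%nat -> Defs.mult K l <> 0%nat -> l = i \/ l = j \/ l = k) ->
  let d := det (ref i) (ref j) (ref k) in
  hull ref K z <->
  0 <= det (ref j) (ref k) z / d /\ 0 <= det (ref k) (ref i) z / d
  /\ 0 <= det (ref i) (ref j) z / d.
Proof.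
  intros Li Lj Lk D ij ik jk Hi Hj Hk HK d.
  split.
  - intros (b & Hb & Hz & H1 & Hx & Hy).
    (* The weights of labels outside 1, ..., 10 may be replaced by 0. *)
    assert (B0 : exists b', (forall l, 0 <= b' l) /\
       (forall l, l <> i -> l <> j -> l <> k -> b' l = 0) /\
       forall l, (1 <= l <= 10)%nat -> b' l = b l).
    { exists (fun l => if ((1 <=? l) && (l <=? 10))%nat then b l else 0); repeat split.
      - intros l; destruct (_ && _)%bool; auto; lra.
      - intros l ni nj nk; destruct ((1 <=? l) && (l <=? 10))%nat eqn:E; [|reflexivity].
        apply andb_prop in E; destruct E as [E1 E2].
        apply Nat.leb_le in E1; apply Nat.leb_le in E2.
        apply Hz; destruct (Nat.eq_dec (Defs.mult K l) 0) as [|N]; [assumption|].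
        destruct (HK l (conj E1 E2) N) as [|[|]]; contradiction.
      - intros l [E1 E2]; apply Nat.leb_le in E1; apply Nat.leb_le in E2.
        now rewrite E1, E2. }
    destruct B0 as (b' & Hb' & Hz' & Eb).
    rewrite (sum_n_m_ext_loc _ b') in H1 by (intros; symmetry; apply Eb; lia).
    rewrite (sum_n_m_ext_loc _ (fun l => b' l * fst (ref l))) in Hx
      by (intros; now rewrite Eb by lia).
    rewrite (sum_n_m_ext_loc _ (fun l => b' l * snd (ref l))) in Hy
      by (intros; now rewrite Eb by lia).
    rewrite (sum_three b' i j k) in H1 by assumption.
    rewrite (sum_three _ i j k) in Hx
      by (assumption || (intros; rewrite Hz' by assumption; apply Rmult_0_l)).
    rewrite (sum_three _ i j k) in Hy
      by (assumption || (intros; rewrite Hz' by assumption; apply Rmult_0_l)).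
    destruct (barycentric_det _ _ _ _ _ _ _ H1 Hx Hy) as (E1 & E2 & E3).
    rewrite E1, E2, E3; fold d; unfold Rdiv; rewrite !Rmult_assoc, Rinv_r, !Rmult_1_r by assumption.
    auto.
  - intros (H1 & H2 & H3).
    pose (b := fun l => if (l =? i)%nat then det (ref j) (ref k) z / d
      else if (l =? j)%nat then det (ref k) (ref i) z / d
      else if (l =? k)%nat then det (ref i) (ref j) z / d else 0).
    assert (Bi : b i = det (ref j) (ref k) z / d) by (unfold b; now rewrite Nat.eqb_refl).
    assert (Bj : b j = det (ref k) (ref i) z / d).
    { unfold b; rewrite Nat.eqb_refl. destruct (Nat.eqb_spec j i); [lia | reflexivity]. }
    assert (Bk : b k = det (ref i) (ref j) z / d).
    { unfold b; rewrite Nat.eqb_refl. destruct (Nat.eqb_spec k i), (Nat.eqb_spec k j); try lia; reflexivity. }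
    assert (B0 : forall l, l <> i -> l <> j -> l <> k -> b l = 0).
    { intros l Ni Nj Nk; unfold b.
      destruct (Nat.eqb_spec l i), (Nat.eqb_spec l j), (Nat.eqb_spec l k); easy. }
    exists b; repeat split.
    + intros l; unfold b; repeat destruct (_ =? _)%nat; try assumption; lra.
    + intros l Hl. assert (S : forall l', In l' (support K) -> l <> l').
      { intros l' Hl' ->; apply filter_In in Hl'; destruct Hl' as [_ Hl'].
        rewrite Hl in Hl'; discriminate. }
      apply B0; now apply S.
    + rewrite (sum_three _ i j k) by assumption. rewrite Bi, Bj, Bk; in_R.
      unfold d, det in *; field; assumption.
    + rewrite (sum_three _ i j k); auto; [|intros; rewrite B0 by assumption; apply Rmult_0_l].
      rewrite Bi, Bj, Bk; in_R; unfold d, det in *; field; assumption.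
    + rewrite (sum_three _ i j k); auto; [|intros; rewrite B0 by assumption; apply Rmult_0_l].
      rewrite Bi, Bj, Bk; in_R; unfold d, det in *; field; assumption.
Qed.

Lemma side_sign s z i j d :
  same_side s z -> label i -> label j -> i <> j -> d <> 0%Z ->
  (0 <= det (ref i) (ref j) z / IZR d) <-> (0 < d * side_at i j s)%Z.
Proof.
  intros H Li Lj N D; specialize (H i j Li Lj N).
  assert (D' : IZR d <> 0) by now apply not_0_IZR.
  assert (P : 0 < IZR d * IZR d) by now apply Rsqr_pos_lt.
  set (u := det (ref i) (ref j) z) in *. set (t := side_at i j s) in *.
  assert (E : IZR d * IZR t * (u / IZR d) = IZR t * u) by (field; assumption).
  split.
  - intros Hu; apply lt_IZR; rewrite mult_IZR.
    destruct (Rlt_or_le 0 (IZR d * IZR t)) as [|C]; [assumption|exfalso].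
    assert (IZR d * IZR t * (u / IZR d) <= 0) by nra. lra.
  - intros Ht; apply IZR_lt in Ht; rewrite mult_IZR in Ht.
    destruct (Rle_or_lt 0 (u / IZR d)) as [|C]; [assumption|exfalso].
    assert (IZR d * IZR t * (u / IZR d) <= 0) by nra. lra.
Qed.

Lemma leaf_correct s K p : leaf s K = Some p -> represents s 0 (K, p).
Proof.
  unfold leaf, represents; destruct (few_labels K) eqn:F; [|discriminate].
  cbn [fst snd Q_rec]; rewrite (find_triangle_ref K F).
  destruct (find_triangleZ K) as [[i [j k]]|] eqn:T.
  2: { intros [= <-] z _; simpl; ring. }
  destruct (find_triangleZ_support _ _ _ _ F T) as ((Li & Lj & Lk) & (Si & Sj & Sk) & D).
  destruct (detZ_distinct _ _ _ D) as (ij & ik & jk).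
  set (d := detZ (refZ i) (refZ j) (refZ k)) in *. set (m := (4 / d)%Z).
  destruct (andb _ _) eqn:E; [|discriminate].
  apply andb_prop in E; destruct E as [Em EK]; apply Z.eqb_eq in Em.
  assert (HK : forall l, (1 <= l <= 10)%nat -> Defs.mult K l <> 0%nat -> l = i \/ l = j \/ l = k).
  { intros l Hl N. assert (E := proj1 (forallb_forall _ _) EK l ltac:(apply in_seq; lia)).
    cbv beta in E; revert E; destruct (Nat.eqb_spec (Defs.mult K l) 0); [contradiction|].
    destruct (Nat.eqb_spec l i), (Nat.eqb_spec l j), (Nat.eqb_spec l k); auto; easy. }
  assert (Ed : det (ref i) (ref j) (ref k) = IZR d) by now apply det_ref.
  assert (D' : IZR d <> 0) by now apply not_0_IZR.
  assert (Hh : forall z, same_side s z -> hull ref K z <->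
     ((0 <? d * side_at j k s) && (0 <? d * side_at k i s) && (0 <? d * side_at i j s))%Z = true).
  { intros z Hz. rewrite (hull_triangle K i j k z) by (rewrite ?Ed; assumption).
    rewrite Ed, !(side_sign s) by auto.
    rewrite !Bool.andb_true_iff, !Z.ltb_lt; tauto. }
  assert (Em' : triangle_area (ref 1) (ref 2) (ref 3) / triangle_area (ref i) (ref j) (ref k)
      = IZR (Z.abs m)).
  { unfold triangle_area; rewrite Ed, det_ref by (unfold label; lia).
    change (detZ (refZ 1) (refZ 2) (refZ 3)) with 4%Z.
    rewrite abs_IZR, <- Em, mult_IZR, Rabs_mult; field. now apply Rabs_no_R0. }
  intros Ep z Hz; specialize (Hh z Hz).
  rewrite Em'.
  destruct (ClassicalEpsilon.excluded_middle_informative _) as [H|H];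
  destruct (andb _ _); injection Ep as <-; simpl; try ring.
  - discriminate (proj1 Hh H).
  - exfalso; apply H, Hh; reflexivity.
Qed.

Definition lookup (K : multiset) (t : list (multiset * poly)) : option poly :=
  option_map snd
    (find (fun e => if list_eq_dec Nat.eq_dec K (fst e) then true else false) t).

Lemma lookup_In K t p : lookup K t = Some p -> In (K, p) t.
Proof.
  unfold lookup; intros H; match type of H with option_map _ ?f = _ =>
    destruct f as [[K' p']|] eqn:E end; [|discriminate].
  injection H as <-; apply find_some in E; destruct E as [E H]; simpl in H.
  now destruct (list_eq_dec Nat.eq_dec K K') as [->|].
Qed.

(** One step of the recurrence, from the polynomials in [prev]. *)
Definition node (prev : list (multiset * poly)) (K : multiset) : option poly :=
  if few_labels K then
    match find_triangleZ K with
    | None => Some []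
    | Some (i, (j, k)) =>
        let d := detZ (refZ i) (refZ j) (refZ k) in
        let m := (4 / d)%Z in
        if (m * d =? 4)%Z then
          match lookup (ms_remove i K) prev, lookup (ms_remove j K) prev,
                lookup (ms_remove k K) prev with
          | Some p, Some q, Some r =>
              Some (pscale m (padd (pmul_form (side_form j k) p)
                                (padd (pmul_form (side_form k i) q)
                                      (pmul_form (side_form i j) r))))
          | _, _, _ => None
          end
        else None
    end
  else None.

Lemma node_correct s n prev K p :
  (forall e, In e prev -> represents s n e) ->
  node prev K = Some p -> represents s (S n) (K, p).
Proof.
  intros Hprev; unfold node; destruct (few_labels K) eqn:F; [|discriminate].
  destruct (find_triangleZ K) as [[i [j k]]|] eqn:T.
  2: { intros [= <-] z _. simpl fst; simpl Q_rec. rewrite find_triangle_ref, T by assumption. simpl; ring. }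
  destruct (find_triangleZ_support _ _ _ _ F T) as ((Li & Lj & Lk) & _ & D).
  destruct (detZ_distinct _ _ _ D) as (ij & ik & jk).
  destruct (Z.eqb_spec (4 / detZ (refZ i) (refZ j) (refZ k) * detZ (refZ i) (refZ j) (refZ k)) 4)
    as [Em|]; [|discriminate].
  destruct (lookup (ms_remove i K) prev) as [pi|] eqn:Pi; [|discriminate].
  destruct (lookup (ms_remove j K) prev) as [pj|] eqn:Pj; [|discriminate].
  destruct (lookup (ms_remove k K) prev) as [pk|] eqn:Pk; [|discriminate].
  apply lookup_In, Hprev in Pi, Pj, Pk.
  intros Ep; apply (f_equal (fun o => match o with Some q => q | None => [] end)) in Ep.
  cbv beta iota in Ep; subst p; intros z Hz. specialize (Pi z Hz); specialize (Pj z Hz); specialize (Pk z Hz).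
  cbn [fst snd] in Pi, Pj, Pk |- *.
  set (d := detZ (refZ i) (refZ j) (refZ k)) in *. set (m := (4 / d)%Z) in *.
  assert (Ed : det (ref i) (ref j) (ref k) = IZR d) by now apply det_ref.
  assert (D' : IZR d <> 0) by now apply not_0_IZR.
  rewrite peval_scale, peval_add, peval_mul_form, peval_add, !peval_mul_form, <- !det_side_form by assumption.
  rewrite <- Pi, <- Pj, <- Pk.
  cbn [Q_rec]; rewrite find_triangle_ref, T by assumption.
  rewrite (sum_three _ i j k); auto.
  2: { intros l Ni Nj Nk; unfold bary_coeff.
       destruct (Nat.eqb_spec l i), (Nat.eqb_spec l j), (Nat.eqb_spec l k); try contradiction.
       apply Rmult_0_l. }
  unfold bary_coeff; rewrite !Nat.eqb_refl, Ed.
  destruct (Nat.eqb_spec j i), (Nat.eqb_spec k i), (Nat.eqb_spec k j); try lia.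
  rewrite (det_cycle z), (det_cycle (ref i) z), (det_cycle z (ref k)).
  replace (4 ^ S n) with (IZR m * IZR d * 4 ^ n)
    by (rewrite <- mult_IZR, Em; simpl; ring).
  field; assumption.
Qed.

Definition children (K : multiset) : list multiset :=
  match find_triangleZ K with
  | None => []
  | Some (i, (j, k)) => [ms_remove i K; ms_remove j K; ms_remove k K]
  end.

Definition collect (f : multiset -> option poly) (Ks : list multiset)
  : list (multiset * poly) :=
  flat_map (fun K => match f K with Some p => [(K, p)] | None => [] end) Ks.

(** The polynomials of the multisets [Ks], computed from those of their distinct
    descendants; keeping each level in a list avoids the exponential repetition of the
    recurrence. *)
Fixpoint table (s : Z * Z * Z) (n : nat) (Ks : list multiset) : list (multiset * poly) :=
  match n with
  | O => collect (leaf s) Ks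
  | S n' =>
      let prev := table s n' (nodup (list_eq_dec Nat.eq_dec) (flat_map children Ks)) in
      collect (node prev) Ks
  end.

Lemma In_collect f Ks e : In e (collect f Ks) -> f (fst e) = Some (snd e).
Proof.
  unfold collect; intros H; apply in_flat_map in H; destruct H as (K & _ & H).
  destruct (f K) eqn:E; [destruct H as [<-|[]]; exact E | destruct H].
Qed.

Lemma table_correct s n Ks e : In e (table s n Ks) -> represents s n e.
Proof.
  revert Ks e; induction n as [|n IH]; intros Ks [K p] H; apply In_collect in H; simpl in H.
  - now apply leaf_correct.
  - eapply node_correct; [|exact H]. intros e He; exact (IH _ _ He).
Qed.

(** * The splines near the common edge *)

(** Points of the six triangles that touch the edge, numbered from 0 in the order in which they
    are met from v1 to v2. *)
Definition samples : list (Z * Z * Z) :=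
  [(2, 4, 20); (10, 2, 20); (17, 4, 20); (19, 4, 20); (30, 2, 20); (34, 4, 20)]%Z.

Definition Bc_multisets : list multiset :=
  nodup (list_eq_dec Nat.eq_dec)
    (flat_map (fun b => map (fun s => ms_image s (snd b)) S3) Bc_representatives).

(** The polynomials on the six triangles, evaluated once and for all. *)
Definition tables : list (list (multiset * poly)) :=
  Eval vm_compute in map (fun s => table s 5 Bc_multisets) samples.

Lemma tables_eq : tables = map (fun s => table s 5 Bc_multisets) samples.
Proof. vm_compute; reflexivity. Qed.

Definition piece (r : nat) (K : multiset) : poly :=
  match lookup K (nth r tables []) with Some p => p | None => [] end.

Definition coef (p : poly) (i j : nat) : Z := nth i (nth j p []) 0%Z.

(** The affine function m with [p] = l^4 m, if there is one.  As the coefficient a of x in l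
    is nonzero for the five lines, m can be read off from the coefficients of x^5, x^4 and
    x^4 y in [p]. *)
Definition cofactor (l : form) (p : poly) : form :=
  let '(a, b, c) := l in
  let mX := (coef p 5 0 / a ^ 4)%Z in
  (mX, (coef p 4 1 - 4 * b * a ^ 3 * mX) / a ^ 4,
   (coef p 4 0 - 4 * c * a ^ 3 * mX) / a ^ 4)%Z.

(** The five lines, each positive on the triangle with the second number and negative on
    the one with the first.  All of them are negative on triangle 4. *)
Definition jumps : list (form * (nat * nat)) :=
  [((-1, 0, 1), (4, 3)%nat); ((-2, -1, 2), (3, 2)%nat); ((-1, -1, 1), (2, 1)%nat);
   ((-1, 1, 0), (1, 0)%nat); ((1, 2, -2), (4, 5)%nat)]%Z.

Definition jump_form (K : multiset) (e : form * (nat * nat)) : form :=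
  let '(l, (r, r')) := e in
  cofactor l (padd (piece r' K) (pscale (-1) (piece r K))).

Definition pzero (p : poly) : bool := forallb (forallb (Z.eqb 0)) p.

Definition jump_ok (K : multiset) (e : form * (nat * nat)) : bool :=
  let '(l, (r, r')) := e in
  pzero (padd (padd (piece r' K) (pscale (-1) (piece r K)))
              (pscale (-1) (pmul_form l (pmul_form l (pmul_form l (pmul_form l
                 (pmul_form (jump_form K e) [[1%Z]]))))))).

Definition tabulated (K : multiset) : bool :=
  (list_sum K - 3 =? 5)%nat
  && forallb (fun r => match lookup K (nth r tables []) with Some _ => true | None => false end)
       (seq 0 6)
  && forallb (jump_ok K) jumps.

Lemma Bc_tabulated K : In K Bc_multisets -> tabulated K = true.
Proof.
  apply (proj1 (forallb_forall tabulated Bc_multisets)); vm_compute; reflexivity.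
Qed.

Lemma peval_zero p z : pzero p = true -> peval p z = 0.
Proof.
  unfold pzero; induction p as [|q p IH]; [reflexivity|].
  cbn [forallb]; intros H; apply andb_prop in H; destruct H as [Hq Hp].
  rewrite peval_cons, IH by assumption.
  assert (E : ueval q (fst z) = 0).
  { clear - Hq; induction q as [|a q IH]; [reflexivity|].
    cbn [forallb] in Hq; apply andb_prop in Hq; destruct Hq as [Ha Hq].
    apply Z.eqb_eq in Ha; rewrite ueval_cons, IH, <- Ha by assumption; simpl; ring. }
  rewrite E; ring.
Qed.

Lemma jump_spec K l r r' z :
  In K Bc_multisets -> In (l, (r, r')) jumps ->
  peval (piece r' K) z = peval (piece r K) z
    + affine (real_form l) z ^ 4 * affine (real_form (jump_form K (l, (r, r')))) z.
Proof.
  intros HK He; apply Bc_tabulated in HK; unfold tabulated in HK.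
  apply andb_prop in HK; destruct HK as [_ HK].
  assert (H := proj1 (forallb_forall _ _) HK _ He).
  cbn [jump_ok] in H.
  apply peval_zero with (z := z) in H; revert H.
  generalize (jump_form K (l, (r, r'))); intros m.
  rewrite peval_add, peval_add, !peval_scale, !peval_mul_form.
  change (peval [[1%Z]] z) with (1 + fst z * 0 + snd z * 0). intros H.
  set (L := affine _ z) in *; set (M := affine _ z) in *; simpl in H |- *; lra.
Qed.

Lemma In_nth_map {A B : Type} (f : A -> list B) l r s x :
  nth_error l r = Some s -> In x (nth r (map f l) []) -> In x (f s).
Proof.
  revert r; induction l as [|a l IH]; intros [|r] H Hx; try discriminate.
  - now injection H as <-.
  - exact (IH r H Hx).
Qed.

Lemma piece_represents r K s z :
  In K Bc_multisets -> nth_error samples r = Some s -> same_side s z ->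
  4 ^ 5 * Q_generic ref K z = peval (piece r K) z.
Proof.
  intros HK Hr Hz; apply Bc_tabulated in HK; unfold tabulated in HK.
  apply andb_prop in HK; destruct HK as [HK _].
  apply andb_prop in HK; destruct HK as [Hs HK]; apply Nat.eqb_eq in Hs.
  assert (Lr : (r < length samples)%nat) by (apply nth_error_Some; now rewrite Hr).
  assert (H := proj1 (forallb_forall _ _) HK r ltac:(apply in_seq; simpl in *; lia)).
  cbv beta in H. unfold piece.
  destruct (lookup K (nth r tables [])) as [p|] eqn:E; [|discriminate].
  apply lookup_In in E. unfold Q_generic; rewrite Hs.
  rewrite tables_eq in E. apply (In_nth_map _ _ _ _ _ Hr) in E.
  exact (table_correct _ _ _ _ E z Hz).
Qed.

(** The spline as a single function near the edge: its polynomial on triangle 4, where all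
    five lines are negative, plus the jump across each line, switched on by a truncated
    power. *)
Definition strip (K : multiset) (z : point) : R :=
  fold_right (fun e s => tpow 4 (affine (real_form (fst e)) z)
                         * affine (real_form (jump_form K e)) z + s)
    (peval (piece 4 K) z) jumps.

Lemma smooth_ext n f g : (forall p, f p = g p) -> smooth n f -> smooth n g.
Proof. intros H Hf; now replace g with f by (apply functional_extensionality, H). Qed.

Lemma smooth_ueval n q : smooth n (fun z => ueval q (fst z)).
Proof.
  induction q as [|a q IH]; [apply (smooth_const n 0)|].
  apply (smooth_plus n (fun _ => IZR a) (fun z => fst z * ueval q (fst z)));
    [apply smooth_const|]; apply smooth_mult; [|exact IH].
  apply smooth_ext with (affine (1, 0, 0)); [intros p; unfold affine; ring|].
  apply smooth_affine.
Qed.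

Lemma smooth_peval n p : smooth n (peval p).
Proof.
  induction p as [|q p IH]; [apply (smooth_const n 0)|].
  apply (smooth_plus n (fun z => ueval q (fst z)) (fun z => snd z * peval p z));
    [apply smooth_ueval|]; apply smooth_mult; [|exact IH].
  apply smooth_ext with (affine (0, 1, 0)); [intros z; unfold affine; ring|].
  apply smooth_affine.
Qed.

Lemma smooth_strip K : smooth 3 (strip K).
Proof.
  unfold strip; induction jumps as [|e l IH]; [apply smooth_peval|].
  cbn [fold_right]; apply smooth_plus; [|exact IH].
  apply smooth_mult; [apply smooth_tpow | apply smooth_affine].
Qed.

Lemma strip_unfold K z :
  let x := fst z in let y := snd z in
  let m i := affine (real_form (jump_form K (nth i jumps ((0, 0, 0)%Z, (0, 0)%nat)))) z in
  strip K z = tpow 4 (1 - x) * m 0%nat + (tpow 4 (2 - 2 * x - y) * m 1%nat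
    + (tpow 4 (1 - x - y) * m 2%nat + (tpow 4 (y - x) * m 3%nat
    + (tpow 4 (x + 2 * y - 2) * m 4%nat + peval (piece 4 K) z)))).
Proof.
  intros x y m.
  replace (1 - x - y) with (affine (real_form (-1, -1, 1)%Z) z) by (unfold x, y; simpl; ring).
  replace (1 - x) with (affine (real_form (-1, 0, 1)%Z) z) by (unfold x; simpl; ring).
  replace (2 - 2 * x - y) with (affine (real_form (-2, -1, 2)%Z) z)
    by (unfold x, y; simpl; ring).
  replace (y - x) with (affine (real_form (-1, 1, 0)%Z) z) by (unfold x, y; simpl; ring).
  replace (x + 2 * y - 2) with (affine (real_form (1, 2, -2)%Z) z)
    by (unfold x, y; simpl; ring).
  reflexivity.
Qed.

(** The closed cells of the five lines along the edge. *)
Definition signs (r : nat) (z : point) : Prop :=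
  let x := fst z in let y := snd z in
  let s (b : bool) (t : R) := if b then 0 <= t else t <= 0 in
  match r with
  | 0%nat => s true (1 - x) /\ s true (2 - 2 * x - y) /\ s true (1 - x - y)
             /\ s true (y - x) /\ s false (x + 2 * y - 2)
  | 1%nat => s true (1 - x) /\ s true (2 - 2 * x - y) /\ s true (1 - x - y)
             /\ s false (y - x) /\ s false (x + 2 * y - 2)
  | 2%nat => s true (1 - x) /\ s true (2 - 2 * x - y) /\ s false (1 - x - y)
             /\ s false (y - x) /\ s false (x + 2 * y - 2)
  | 3%nat => s true (1 - x) /\ s false (2 - 2 * x - y) /\ s false (1 - x - y)
             /\ s false (y - x) /\ s false (x + 2 * y - 2)
  | 4%nat => s false (1 - x) /\ s false (2 - 2 * x - y) /\ s false (1 - x - y)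
             /\ s false (y - x) /\ s false (x + 2 * y - 2)
  | 5%nat => s false (1 - x) /\ s false (2 - 2 * x - y) /\ s false (1 - x - y)
             /\ s false (y - x) /\ s true (x + 2 * y - 2)
  | _ => False
  end.

(** Each of the six triangles is reached from triangle 4 by crossing some of the lines, one
    after the other, and these are the lines whose truncated powers are switched on. *)
Lemma strip_pieces K r z :
  In K Bc_multisets -> signs r z -> strip K z = peval (piece r K) z.
Proof.
  intros HK Hr; revert Hr; unfold signs.
  set (x := fst z); set (y := snd z); cbv zeta iota.
  assert (J3 := fun l r r' => jump_spec K l r r' z HK).
  assert (E3 := J3 (-1, 0, 1)%Z 4%nat 3%nat ltac:(simpl; tauto)).
  assert (E2 := J3 (-2, -1, 2)%Z 3%nat 2%nat ltac:(simpl; tauto)).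
  assert (E1 := J3 (-1, -1, 1)%Z 2%nat 1%nat ltac:(simpl; tauto)).
  assert (E0 := J3 (-1, 1, 0)%Z 1%nat 0%nat ltac:(simpl; tauto)).
  assert (E5 := J3 (1, 2, -2)%Z 4%nat 5%nat ltac:(simpl; tauto)).
  clear J3.
  intros Hr; destruct r as [|[|[|[|[|[|r]]]]]]; [..|contradiction];
  destruct Hr as (H0 & H1 & H2 & H3 & H4).
  all: rewrite ?E0, ?E1, ?E2, ?E3, ?E5, strip_unfold; cbn [nth jumps]; unfold form; fold x y.
  all: generalize (affine (real_form (jump_form K (-1, 0, 1, (4%nat, 3%nat))%Z)) z)
    (affine (real_form (jump_form K (-2, -1, 2, (3%nat, 2%nat))%Z)) z)
    (affine (real_form (jump_form K (-1, -1, 1, (2%nat, 1%nat))%Z)) z)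
    (affine (real_form (jump_form K (-1, 1, 0, (1%nat, 0%nat))%Z)) z)
    (affine (real_form (jump_form K (1, 2, -2, (4%nat, 5%nat))%Z)) z)
    (peval (piece 4 K) z); intros m3 m2 m1 m0 m5 b.
  all: clear - H0 H1 H2 H3 H4; unfold real_form, affine; fold x y;
  repeat match goal with
       | H : 0 <= ?t |- context [tpow 4 ?t] => rewrite (tpow_pos 4 t H)
       | H : ?t <= 0 |- context [tpow 4 ?t] => rewrite (tpow_neg 3 t H)
       end; ring.
Qed.

Lemma same_side_sample s z :
  (forall i j, label i -> label j -> i <> j ->
     0 < IZR (side_at i j s) * affine (real_form (side_form i j)) z) ->
  same_side s z.
Proof.
  intros H i j Hi Hj N; rewrite det_side_form by assumption; now apply H.
Qed.

Ltac check_sides :=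
  apply same_side_sample; intros i j [Hi Hi'] [Hj Hj'] N;
  do 7 (destruct i as [|i]; [try lia;
    do 7 (destruct j as [|j]; [try lia; unfold affine, side_at, side_form, real_form; simpl; lra|]);
    lia|]);
  lia.

Lemma generic_lines z :
  generic ref z ->
  let x := fst z in let y := snd z in
  x <> 0 /\ y <> 0 /\ x + y - 2 <> 0 /\ y - x <> 0 /\ x + 2 * y - 2 <> 0 /\
  2 - 2 * x - y <> 0 /\ 1 - x <> 0 /\ 1 - x - y <> 0.
Proof.
  intros G.
  assert (G12 := G 1%nat 2%nat ltac:(lia) ltac:(lia) ltac:(lia)).
  assert (G13 := G 1%nat 3%nat ltac:(lia) ltac:(lia) ltac:(lia)).
  assert (G23 := G 2%nat 3%nat ltac:(lia) ltac:(lia) ltac:(lia)).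
  assert (G15 := G 1%nat 5%nat ltac:(lia) ltac:(lia) ltac:(lia)).
  assert (G26 := G 2%nat 6%nat ltac:(lia) ltac:(lia) ltac:(lia)).
  assert (G34 := G 3%nat 4%nat ltac:(lia) ltac:(lia) ltac:(lia)).
  assert (G45 := G 4%nat 5%nat ltac:(lia) ltac:(lia) ltac:(lia)).
  assert (G46 := G 4%nat 6%nat ltac:(lia) ltac:(lia) ltac:(lia)).
  unfold det, ref, vertex, midpoint in *; simpl in *.
  repeat split; lra.
Qed.

(** For y < 1/2 the signs of the five lines determine those of all others, which is why
    only six cells occur. *)
Lemma sample_side z :
  in_ref z -> snd z < 1/2 -> generic ref z ->
  exists r s, nth_error samples r = Some s /\ same_side s z /\ signs r z.
Proof.
  intros (X0 & Y0 & S0) Y1 G.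
  destruct (generic_lines z G) as (GX & GY & GS & G15 & G26 & G34 & G45 & G46); clear G.
  destruct z as [x y]; cbn [fst snd] in *.
  assert (X1 : 0 < x) by lra. assert (Y2 : 0 < y) by lra. assert (S1 : x + y < 2) by lra.
  clear X0 Y0 S0 GX GY GS; unfold signs; cbn [fst snd].
  destruct (Rtotal_order (y - x) 0) as [H1|[H1|H1]]; [|contradiction|]; clear G15.
  2: { clear G26 G34 G45 G46; exists 0%nat; eexists; repeat split; [check_sides | lra..]. }
  destruct (Rtotal_order (1 - x - y) 0) as [H2|[H2|H2]]; [|contradiction|]; clear G46.
  2: { clear G26 G34 G45; exists 1%nat; eexists; repeat split; [check_sides | lra..]. }
  destruct (Rtotal_order (2 - 2 * x - y) 0) as [H3|[H3|H3]]; [|contradiction|]; clear G34.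
  2: { clear G26 G45; exists 2%nat; eexists; repeat split; [check_sides | lra..]. }
  destruct (Rtotal_order (1 - x) 0) as [H4|[H4|H4]]; [|contradiction|]; clear G45.
  2: { clear G26; exists 3%nat; eexists; repeat split; [check_sides | lra..]. }
  destruct (Rtotal_order (x + 2 * y - 2) 0) as [H5|[H5|H5]]; [|contradiction|]; clear G26.
  - exists 4%nat; eexists; repeat split; [check_sides | lra..].
  - exists 5%nat; eexists; repeat split; [check_sides | lra..].
Qed.

Lemma strip_value K z :
  In K Bc_multisets -> in_ref z -> snd z < 1/2 -> generic ref z ->
  4 ^ 5 * Q_generic ref K z = strip K z.
Proof.
  intros HK Hz Yz G; destruct (sample_side z Hz Yz G) as (r & s & Hr & Hs & Hsig).
  rewrite (strip_pieces K r z HK Hsig); exact (piece_represents r K s z HK Hr Hs).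
Qed.

Definition strip_spline (B : list wspline) (c : nat -> R) (z : point) : R :=
  sum_n_m (fun i => let b := nth (i - 1) B (0, []) in
                    c i * (fst b * (/ 4 ^ 5 * strip (snd b) z))) 1 39.

Lemma smooth_sum n (f : nat -> point -> R) m :
  (forall i, smooth n (f i)) -> smooth n (fun z => sum_n_m (fun i => f i z) 1 m).
Proof.
  intros H; induction m as [|m IH].
  - apply smooth_ext with (fun _ => 0); [|apply smooth_const].
    intros z; now rewrite sum_n_m_zero by lia.
  - apply smooth_ext with (fun z => sum_n_m (fun i => f i z) 1 m + f (S m) z).
    + intros z; now rewrite sum_n_Sm by lia.
    + apply smooth_plus; auto.
Qed.

Lemma smooth_strip_spline B c : smooth 3 (strip_spline B c).
Proof.
  apply (smooth_sum 3 (fun i z => let b := nth (i - 1) B (0, []) in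
                    c i * (fst b * (/ 4 ^ 5 * strip (snd b) z)))).
  intros i; apply smooth_scal, smooth_scal, smooth_scal, smooth_strip.
Qed.

Lemma in_Bc_multisets b : in_Bc b -> In (snd b) Bc_multisets.
Proof.
  intros (w & K & s & HK & Hs & ->); apply nodup_In, in_flat_map; exists (w, K); split.
  - exact HK.
  - exact (in_map (fun s => ms_image s K) _ _ Hs).
Qed.

Lemma spline_strip v1 v2 v3 B c x :
  det v1 v2 v3 <> 0 -> (forall b, In b B -> in_Bc b) ->
  hull (vertex v1 v2 v3) whole_triangle x -> snd (chart v1 v2 v3 x) < 1/2 ->
  spline (vertex v1 v2 v3) B c x = strip_spline B c (chart v1 v2 v3 x).
Proof.
  intros D HB Hx Sx; unfold spline, strip_spline; apply sum_n_m_ext; intros i.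
  destruct (nth_in_or_default (i - 1) B (0, [])) as [Hi|E].
  - apply HB, in_Bc_multisets in Hi.
    do 2 f_equal. apply (Q_value v1 v2 v3 D (snd (nth (i - 1) B (0, [])))
      (fun z => / 4 ^ 5 * strip (snd (nth (i - 1) B (0, []))) z)); auto.
    + intros q; apply (smooth_continuous 3), smooth_scal, smooth_strip.
    + intros q Hq Yq Gq; rewrite <- strip_value by assumption; field.
  - rewrite E; simpl; ring.
Qed.

(** * Transversal derivatives on the two halves of the edge *)

Section Directional.
Variables b2 b3 : R.

Definition dir_deriv (f : point -> R) (p : point) : R := b2 * dx f p + b3 * dy f p.

(** The transition from the coordinates of the second triangle to those of the first. *)
Definition shear : point -> point := affine_map (1, b2, 0) (0, b3, 0).

Lemma smooth_dir_deriv n f : smooth (S n) f -> smooth n (dir_deriv f).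
Proof. intros H; apply smooth_plus; apply smooth_scal, H. Qed.

Lemma iter_dy_shear k F :
  smooth k F ->
  Nat.iter k dy (fun q => F (shear q)) = fun q => Nat.iter k dir_deriv F (shear q).
Proof.
  revert F; induction k as [|k IH]; intros F SF; [reflexivity|].
  rewrite !Nat.iter_succ_r; unfold shear; rewrite dy_comp by now apply smooth_1 in SF.
  apply (IH (dir_deriv F)), smooth_dir_deriv, SF.
Qed.

Lemma iter_dir_deriv_local k f g p :
  locally p (fun q => f q = g q) ->
  locally p (fun q => Nat.iter k dir_deriv f q = Nat.iter k dir_deriv g q).
Proof.
  intros H; induction k as [|k IH]; [exact H|].
  change (locally p (fun q => dir_deriv (Nat.iter k dir_deriv f) q = dir_deriv (Nat.iter k dir_deriv g) q)).
  generalize (filter_and _ _ (dx_local _ _ _ IH) (dy_local _ _ _ IH)).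
  apply filter_imp; intros q [Hx Hy]; unfold dir_deriv at 1 3.
  now rewrite Hx, Hy.
Qed.

Lemma iter_dir_deriv_lin k a b f g :
  smooth k f -> smooth k g ->
  Nat.iter k dir_deriv (fun q => a * f q + b * g q)
  = fun q => a * Nat.iter k dir_deriv f q + b * Nat.iter k dir_deriv g q.
Proof.
  revert f g; induction k as [|k IH]; intros f g Sf Sg; [reflexivity|].
  assert (Sf1 := smooth_1 _ _ Sf). assert (Sg1 := smooth_1 _ _ Sg).
  rewrite !Nat.iter_succ_r, <- IH by (now apply smooth_dir_deriv); f_equal.
  apply functional_extensionality; intros q; unfold dir_deriv.
  rewrite (dx_plus (fun q => a * f q)), (dy_plus (fun q => a * f q)), !dx_scal, !dy_scal
    by auto using smooth_scal.
  ring.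
Qed.

Fixpoint uderiv (q : upoly) : upoly :=
  match q with [] => [] | a :: q' => zip Z.add q' (0%Z :: uderiv q') end.
Definition pdX : poly -> poly := map uderiv.
Fixpoint pdY (p : poly) : poly :=
  match p with [] => [] | q :: p' => padd p' ([] :: pdY p') end.

Lemma is_derive_ueval q x : is_derive (ueval q) x (ueval (uderiv q) x).
Proof.
  induction q as [|a q IH]; [exact (is_derive_const (0 : R_NormedModule) x)|].
  cbn [uderiv]; rewrite ueval_add, ueval_cons.
  apply is_derive_ext with (fun x => IZR a + x * ueval q x); [reflexivity|].
  replace (_ + _) with (plus zero (plus (mult one (ueval q x)) (mult x (ueval (uderiv q) x)))).
  - apply @is_derive_plus; [apply @is_derive_const|].
    apply (is_derive_mult (fun x : R => x) (ueval q) x).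
    + apply @is_derive_id.
    + exact IH.
    + intros; apply Rmult_comm.
  - unfold plus, mult, zero, one; simpl; ring.
Qed.

Lemma dx_peval p : dx (peval p) = peval (pdX p).
Proof.
  apply dx_unique; intros [x y]; cbn [fst snd].
  induction p as [|q p IH]; [exact (is_derive_const (0 : R_NormedModule) x)|].
  cbn [pdX map]; rewrite peval_cons.
  apply is_derive_ext with (fun t => ueval q t + y * peval p (t, y)); [reflexivity|].
  apply @is_derive_plus; [apply is_derive_ueval|].
  apply (is_derive_scal (fun t => peval p (t, y))), IH.
Qed.

Lemma dy_peval p : dy (peval p) = peval (pdY p).
Proof.
  apply dy_unique; intros [x y]; cbn [fst snd].
  induction p as [|q p IH]; [exact (is_derive_const (0 : R_NormedModule) y)|].
  cbn [pdY]; rewrite peval_add, peval_cons; cbn [fst snd].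
  apply is_derive_ext with (fun t => ueval q x + t * peval p (x, t)); [reflexivity|].
  replace (_ + _) with (plus zero (plus (mult one (peval p (x, y))) (mult y (peval (pdY p) (x, y))))).
  - apply @is_derive_plus; [apply @is_derive_const|].
    apply (is_derive_mult (fun t : R => t) (fun t => peval p (x, t)) y).
    + apply @is_derive_id.
    + exact IH.
    + intros; apply Rmult_comm.
  - unfold plus, mult, zero, one; simpl; ring.
Qed.

(** The derivative of order [k] of a polynomial in the direction [(b2, b3)]. *)
Fixpoint dir_value (k : nat) (p : poly) (z : point) : R :=
  match k with
  | O => peval p z
  | S k' => b2 * dir_value k' (pdX p) z + b3 * dir_value k' (pdY p) z
  end.

Lemma iter_dir_deriv_peval k p : Nat.iter k dir_deriv (peval p) = dir_value k p.
Proof.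
  revert p; induction k as [|k IH]; intros p; [reflexivity|].
  rewrite Nat.iter_succ_r.
  replace (dir_deriv (peval p)) with (fun q => b2 * peval (pdX p) q + b3 * peval (pdY p) q).
  - rewrite iter_dir_deriv_lin, !IH by apply smooth_peval; reflexivity.
  - apply functional_extensionality; intros q; unfold dir_deriv; now rewrite dx_peval, dy_peval.
Qed.

Lemma iter_dir_deriv_sum k (a : nat -> R) (P : nat -> poly) m z :
  Nat.iter k dir_deriv (fun z => sum_n_m (fun i => a i * peval (P i) z) 1 m) z
  = sum_n_m (fun i => a i * dir_value k (P i) z) 1 m.
Proof.
  revert z; induction m as [|m IH]; intros z.
  - rewrite sum_n_m_zero by lia.
    replace (fun z => sum_n_m (fun i => a i * peval (P i) z) 1 0) with (peval []).
    + rewrite iter_dir_deriv_peval; clear; induction k as [|k IH]; [reflexivity|].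
      simpl; rewrite IH; unfold zero; simpl; ring.
    + apply functional_extensionality; intros q; now rewrite sum_n_m_zero by lia.
  - replace (fun z => sum_n_m (fun i => a i * peval (P i) z) 1 (S m))
      with (fun z => 1 * sum_n_m (fun i => a i * peval (P i) z) 1 m
                     + a (S m) * peval (P (S m)) z).
    + rewrite iter_dir_deriv_lin.
      * rewrite IH, iter_dir_deriv_peval, (sum_n_Sm _ 1 m) by lia; unfold plus; simpl; ring.
      * apply (smooth_sum k (fun i z => a i * peval (P i) z)).
        intros i; apply smooth_scal, smooth_peval.
      * apply smooth_peval.
    + apply functional_extensionality; intros q; rewrite sum_n_Sm by lia.
      unfold plus; simpl; ring.
Qed.

(** All formal derivatives of order [k] vanish on the axis. *)
Fixpoint poly_flat (k : nat) (p : poly) : bool :=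
  match k with
  | O => forallb (Z.eqb 0) (hd [] p)
  | S k' => poly_flat k' (pdX p) && poly_flat k' (pdY p)
  end.

Lemma poly_flat_dir_value k p x : poly_flat k p = true -> dir_value k p (x, 0) = 0.
Proof.
  revert p; induction k as [|k IH]; intros p H; cbn [poly_flat dir_value] in *.
  - destruct p as [|q p]; [reflexivity|].
    rewrite peval_cons; cbn [fst snd hd] in *.
    replace (ueval q x) with (peval [q] (x, 0)) by (rewrite peval_cons; simpl; ring).
    rewrite peval_zero; [ring|]. unfold pzero; cbn [forallb]; now rewrite H.
  - apply andb_prop in H; destruct H as [Hx Hy]; rewrite !IH by assumption; ring.
Qed.
End Directional.

Lemma dy_dir_deriv f : dy f = dir_deriv 0 1 f.
Proof. apply functional_extensionality; intros p; unfold dir_deriv; ring. Qed.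

Lemma iter_dy_dir_deriv k f : Nat.iter k dy f = Nat.iter k (dir_deriv 0 1) f.
Proof.
  induction k as [|k IH]; [reflexivity|].
  simpl; rewrite IH; apply dy_dir_deriv.
Qed.

(** The open halves of the edge, each labelled by the triangle that lies along it. *)
Definition side (r : nat) (x : R) : Prop :=
  r = 1%nat /\ 0 < x < 1 \/ r = 4%nat /\ 1 < x < 2.

Lemma affine_pos_near L p : 0 < affine L p -> locally p (fun q => 0 < affine L q).
Proof.
  intros H; apply (continuous_affine L p (fun y => 0 < y)).
  apply (locally_open (fun y => 0 < y)); [apply open_gt | auto | assumption].
Qed.

Lemma signs_near r x : side r x -> locally (x, 0) (signs r).
Proof.
  assert (N : forall a b c, 0 < a * x + c ->
     locally (x, 0) (fun q : point => 0 < a * fst q + b * snd q + c)).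
  { intros a b c H; apply (affine_pos_near (a, b, c)); simpl; lra. }
  intros [[-> H]|[-> H]]; unfold signs.
  - generalize (N (-1) 0 1 ltac:(lra)) (N (-2) (-1) 2 ltac:(lra)) (N (-1) (-1) 1 ltac:(lra))
      (N 1 (-1) 0 ltac:(lra)) (N (-1) (-2) 2 ltac:(lra)); intros N1 N2 N3 N4 N5.
    generalize (filter_and _ _ N1 (filter_and _ _ N2 (filter_and _ _ N3 (filter_and _ _ N4 N5)))).
    apply filter_imp; intros q Hq; lra.
  - generalize (N 1 0 (-1) ltac:(lra)) (N 2 1 (-2) ltac:(lra)) (N 1 1 (-1) ltac:(lra))
      (N 1 (-1) 0 ltac:(lra)) (N (-1) (-2) 2 ltac:(lra)); intros N1 N2 N3 N4 N5.
    generalize (filter_and _ _ N1 (filter_and _ _ N2 (filter_and _ _ N3 (filter_and _ _ N4 N5)))).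
    apply filter_imp; intros q Hq; lra.
Qed.

Definition vanishing (K : multiset) : bool :=
  forallb (fun r => forallb (fun k => poly_flat k (piece r K)) (seq 0 4)) [1; 4]%nat.

(** Enumeration of the 39 elements: 14 of them have at most three knots on the edge,
    counted with multiplicities, hence vanish to order 3 there. *)
Lemma in_Bc_cases b : in_Bc b -> In b Bc_first25 \/ vanishing (snd b) = true.
Proof.
  intros (w & K & s & HK & Hs & ->).
  cbn [In Bc_representatives S3] in HK, Hs.
  repeat destruct HK as [HK|HK]; try contradiction; injection HK as <- <-;
  repeat destruct Hs as [Hs|Hs]; try contradiction; subst s;
  try (right; vm_compute; reflexivity);
  left; unfold Bc_first25;
  match goal with |- In (_, ?m) _ => let m' := eval vm_compute in m in change m with m' end;
  cbn [In]; repeat (first [left; reflexivity | right]).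
Qed.

(** The derivative of order [k] at [(x, 0)] in the direction [(b2, b3)] of the combination
    of the first 25 basis elements. *)
Definition transversal (r k : nat) (b2 b3 : R) (c : nat -> R) (x : R) : R :=
  sum_n_m (fun i => let b := nth (i - 1) Bc_first25 (0, []) in
     c i * (fst b / 4 ^ 5) * dir_value b2 b3 k (piece r (snd b)) (x, 0)) 1 25.

(** On a half of the edge the splines are polynomials, and only the first 25 basis elements
    contribute. *)
Lemma iter_dy_strip B r k b2 b3 c x :
  Bc_ordering B -> side r x -> (k <= 3)%nat ->
  Nat.iter k dy (fun q => strip_spline B c (shear b2 b3 q)) (x, 0) = transversal r k b2 b3 c x.
Proof.
  intros (ND & HB & H25) Hr Hk.
  rewrite iter_dy_shear by (apply smooth_le with 3%nat; [assumption | apply smooth_strip_spline]).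
  replace (shear b2 b3 (x, 0)) with (x, 0)
    by (unfold shear, affine_map, affine; simpl; f_equal; ring).
  pose (b i := nth (i - 1) B (0, [])).
  transitivity (sum_n_m (fun i => c i * (fst (b i) / 4 ^ 5)
     * dir_value b2 b3 k (piece r (snd (b i))) (x, 0)) 1 39).
  - rewrite <- iter_dir_deriv_sum.
    apply (locally_singleton (x, 0) (fun q => Nat.iter k (dir_deriv b2 b3) (strip_spline B c) q
      = Nat.iter k (dir_deriv b2 b3) (fun z => sum_n_m (fun i => c i * (fst (b i) / 4 ^ 5)
          * peval (piece r (snd (b i))) z) 1 39) q)).
    apply iter_dir_deriv_local.
    generalize (signs_near r x Hr); apply filter_imp; intros q Hq.
    apply sum_n_m_ext; intros i.
    change (c i * (fst (b i) * (/ 4 ^ 5 * strip (snd (b i)) q))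
            = c i * (fst (b i) / 4 ^ 5) * peval (piece r (snd (b i))) q).
    destruct (nth_in_or_default (i - 1) B (0, [])) as [Hi|E].
    + rewrite (strip_pieces _ r) by (auto; apply in_Bc_multisets, HB, Hi).
      unfold Rdiv; ring.
    + unfold b; rewrite E; simpl fst; unfold Rdiv; ring.
  - rewrite (sum_n_m_Chasles _ 1 25 39) by lia.
    rewrite (sum_n_m_ext_loc _ (fun _ => zero) 26 39).
    + rewrite sum_n_m_const_zero, plus_zero_r.
      apply sum_n_m_ext_loc; intros i Hi.
      replace (b i) with (nth (i - 1) Bc_first25 (0, [])); [reflexivity|].
      unfold b; rewrite <- H25, nth_firstn.
      replace (i - 1 <? 25)%nat with true; [reflexivity|].
      symmetry; apply Nat.ltb_lt; lia.
    + intros i Hi.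
      destruct (nth_in_or_default (i - 1) B (0, [])) as [Hb|E].
      * destruct (le_lt_dec (length B) (i - 1)) as [Hlen|Hlen].
        { unfold b; rewrite nth_overflow by assumption; simpl fst; unfold Rdiv, zero; simpl; ring. }
        destruct (in_Bc_cases _ (proj1 (HB _) Hb)) as [H|H].
        -- exfalso. rewrite <- H25 in H.
           apply In_nth with (d := (0, [])) in H; destruct H as (j & Hj & E).
           rewrite length_firstn in Hj. rewrite nth_firstn in E.
           replace (j <? 25)%nat with true in E by (symmetry; apply Nat.ltb_lt; lia).
           apply (proj1 (NoDup_nth B (0, []))) in E; auto; lia.
        -- fold (b i) in H. rewrite poly_flat_dir_value; [apply Rmult_0_r|].
           unfold vanishing in H; cbn [forallb] in H.
           apply andb_prop in H; destruct H as [H1 H4].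
           apply andb_prop in H4; destruct H4 as [H4 _].
           destruct Hr as [[-> _]|[-> _]].
           ++ apply (proj1 (forallb_forall _ _) H1), in_seq; lia.
           ++ apply (proj1 (forallb_forall _ _) H4), in_seq; lia.
      * unfold b; rewrite E; simpl fst; unfold Rdiv, zero; simpl; ring.
Qed.

(** * The conditions on the coefficients *)

(** The directional derivative of order [k] of the [i]-th basis element, multiplied by the
    factor 4^5 that makes its polynomials integral. *)
Definition trace (r k i : nat) (b2 b3 x : R) : R :=
  let b := nth (i - 1) Bc_first25 (0, []) in
  fst b * dir_value b2 b3 k (piece r (snd b)) (x, 0).

Lemma sum_n_m_seq (f : nat -> R) n :
  sum_n_m f 1 n = fold_right (fun i s => f i + s) 0 (seq 1 n).
Proof.
  assert (E : forall n m, sum_n_m f (S m) (m + n) = fold_right (fun i s => f i + s) 0 (seq (S m) n)).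
  { clear n; induction n as [|n IH]; intros m.
    - rewrite sum_n_m_zero by lia; reflexivity.
    - rewrite sum_Sn_m by lia. cbn [seq fold_right]; rewrite <- IH.
      replace (m + S n)%nat with (S m + n)%nat by lia; reflexivity. }
  exact (E n 0%nat).
Qed.

Lemma transversal_traces r k b2 b3 c x :
  transversal r k b2 b3 c x
  = fold_right (fun i s => c i * trace r k i b2 b3 x + s) 0 (seq 1 25) / 1024.
Proof.
  unfold transversal; rewrite sum_n_m_seq.
  induction (seq 1 25) as [|i l IH]; cbn [fold_right]; [unfold Rdiv; ring|].
  rewrite IH; unfold trace; cbv zeta; field.
Qed.

Definition traces_sum (r k : nat) (x : R) (l : list (R * nat)) : R :=
  fold_right (fun e s => fst e * trace r k (snd e) 0 1 x + s) 0 l.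

Ltac expand_traces :=
  unfold traces_sum; rewrite ?transversal_traces;
  cbv -[IZR Rplus Rmult Rminus Ropp Rdiv Rinv].

(** A combination of the traces is a C^3 spline of degree 5 with the break x = 1.  If it
    vanishes at six points of the first half, it is 0 there and a multiple of (x-1)^4 on the
    second half, where two more zeros make it vanish.  For the derivatives of order k the
    smoothness, the degree and the number of points of the first half go down by k. *)
Lemma traces_independent0 a1 a2 a3 a4 a5 a6 a7 a8 :
  (forall r x, side r x ->
     traces_sum r 0 x [(a1, 1%nat); (a2, 2%nat); (a3, 3%nat); (a4, 4%nat);
        (a5, 5%nat); (a6, 6%nat); (a7, 7%nat); (a8, 8%nat)] = 0) ->
  a1 = 0 /\ a2 = 0 /\ a3 = 0 /\ a4 = 0 /\ a5 = 0 /\ a6 = 0 /\ a7 = 0 /\ a8 = 0.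
Proof.
  intros H.
  assert (H1 := H 1%nat (1/7) ltac:(left; split; [reflexivity | lra])).
  assert (H2 := H 1%nat (2/7) ltac:(left; split; [reflexivity | lra])).
  assert (H3 := H 1%nat (3/7) ltac:(left; split; [reflexivity | lra])).
  assert (H4 := H 1%nat (4/7) ltac:(left; split; [reflexivity | lra])).
  assert (H5 := H 1%nat (5/7) ltac:(left; split; [reflexivity | lra])).
  assert (H6 := H 1%nat (6/7) ltac:(left; split; [reflexivity | lra])).
  assert (H7 := H 4%nat (4/3) ltac:(right; split; [reflexivity | lra])).
  assert (H8 := H 4%nat (5/3) ltac:(right; split; [reflexivity | lra])).
  clear H; unfold traces_sum in *; cbv -[IZR Rplus Rmult Rminus Ropp Rdiv Rinv] in *.
  repeat split; lra.
Qed.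

Lemma traces_independent1 a9 a15 a10 a14 a11 a13 a12 :
  (forall r x, side r x ->
     traces_sum r 1 x [(a9, 9%nat); (a15, 15%nat); (a10, 10%nat); (a14, 14%nat);
        (a11, 11%nat); (a13, 13%nat); (a12, 12%nat)] = 0) ->
  a9 = 0 /\ a15 = 0 /\ a10 = 0 /\ a14 = 0 /\ a11 = 0 /\ a13 = 0 /\ a12 = 0.
Proof.
  intros H.
  assert (H1 := H 1%nat (1/6) ltac:(left; split; [reflexivity | lra])).
  assert (H2 := H 1%nat (2/6) ltac:(left; split; [reflexivity | lra])).
  assert (H3 := H 1%nat (3/6) ltac:(left; split; [reflexivity | lra])).
  assert (H4 := H 1%nat (4/6) ltac:(left; split; [reflexivity | lra])).
  assert (H5 := H 1%nat (5/6) ltac:(left; split; [reflexivity | lra])).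
  assert (H6 := H 4%nat (4/3) ltac:(right; split; [reflexivity | lra])).
  assert (H7 := H 4%nat (5/3) ltac:(right; split; [reflexivity | lra])).
  clear H; unfold traces_sum in *; cbv -[IZR Rplus Rmult Rminus Ropp Rdiv Rinv] in *.
  repeat split; lra.
Qed.

Lemma traces_independent2 a16 a17 a18 a19 a20 a21 :
  (forall r x, side r x ->
     traces_sum r 2 x [(a16, 16%nat); (a17, 17%nat); (a18, 18%nat); (a19, 19%nat);
        (a20, 20%nat); (a21, 21%nat)] = 0) ->
  a16 = 0 /\ a17 = 0 /\ a18 = 0 /\ a19 = 0 /\ a20 = 0 /\ a21 = 0.
Proof.
  intros H.
  assert (H1 := H 1%nat (1/5) ltac:(left; split; [reflexivity | lra])).
  assert (H2 := H 1%nat (2/5) ltac:(left; split; [reflexivity | lra])).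
  assert (H3 := H 1%nat (3/5) ltac:(left; split; [reflexivity | lra])).
  assert (H4 := H 1%nat (4/5) ltac:(left; split; [reflexivity | lra])).
  assert (H5 := H 4%nat (4/3) ltac:(right; split; [reflexivity | lra])).
  assert (H6 := H 4%nat (5/3) ltac:(right; split; [reflexivity | lra])).
  clear H; unfold traces_sum in *; cbv -[IZR Rplus Rmult Rminus Ropp Rdiv Rinv] in *.
  repeat split; lra.
Qed.

(** The last function completes the traces of the four new basis elements to a basis of the
    continuous splines of degree 2. *)
Lemma traces_independent3 a22 a23 a24 a25 z :
  (forall r x, side r x ->
     traces_sum r 3 x [(a22, 22%nat); (a23, 23%nat); (a24, 24%nat); (a25, 25%nat)]
     + z * (if (r =? 1)%nat then x * x else (2 - x) * (2 - x)) = 0) ->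
  a22 = 0 /\ a23 = 0 /\ a24 = 0 /\ a25 = 0 /\ z = 0.
Proof.
  intros H.
  assert (H1 := H 1%nat (1/4) ltac:(left; split; [reflexivity | lra])).
  assert (H2 := H 1%nat (2/4) ltac:(left; split; [reflexivity | lra])).
  assert (H3 := H 1%nat (3/4) ltac:(left; split; [reflexivity | lra])).
  assert (H4 := H 4%nat (4/3) ltac:(right; split; [reflexivity | lra])).
  assert (H5 := H 4%nat (5/3) ltac:(right; split; [reflexivity | lra])).
  clear H; unfold traces_sum in *; cbv -[IZR Rplus Rmult Rminus Ropp Rdiv Rinv] in *.
  repeat split; lra.
Qed.

Definition gap (k : nat) (b2 b3 : R) (c d : nat -> R) (r : nat) (x : R) : R :=
  transversal r k b2 b3 c x - transversal r k 0 1 d x.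

Ltac use_C0 H :=
  rewrite ?(H 1%nat), ?(H 2%nat), ?(H 3%nat), ?(H 4%nat), ?(H 5%nat), ?(H 6%nat),
    ?(H 7%nat), ?(H 8%nat) by lia.

(** The four lemmas of this form rest on a polynomial identity [Id] on either half of the
    edge: the gap is the combination of the traces with the differences of the two sides of
    the conditions as coefficients. *)
Lemma C0_iff_gap b1 b2 b3 c d :
  b1 + b2 + b3 = 1 -> (forall r x, side r x -> gap 0 b2 b3 c d r x = 0) <-> C0_conditions c d.
Proof.
  intros Hb. replace b1 with (1 - b2 - b3) in * by lra; clear Hb b1.
    assert (Id : forall r x, side r x -> 1024 * gap 0 b2 b3 c d r x =
      traces_sum r 0 x [(c 1%nat - d 1%nat, 1%nat); (c 2%nat - d 2%nat, 2%nat);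
         (c 3%nat - d 3%nat, 3%nat); (c 4%nat - d 4%nat, 4%nat);
         (c 5%nat - d 5%nat, 5%nat); (c 6%nat - d 6%nat, 6%nat);
         (c 7%nat - d 7%nat, 7%nat); (c 8%nat - d 8%nat, 8%nat)]).
  - intros r x [[-> _]|[-> _]]; unfold gap; expand_traces;
    field.
  - split.
    + intros H.
      destruct (traces_independent0 (c 1%nat - d 1%nat) (c 2%nat - d 2%nat)
        (c 3%nat - d 3%nat) (c 4%nat - d 4%nat) (c 5%nat - d 5%nat)
        (c 6%nat - d 6%nat) (c 7%nat - d 7%nat) (c 8%nat - d 8%nat))
        as (G1 & G2 & G3 & G4 & G5 & G6 & G7 & G8).
      { intros r x Hs; rewrite <- (Id r x Hs), H by assumption; ring. }
      intros i Hi Hi'; do 9 (destruct i as [|i]; [try lia; lra|]); lia.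
    + intros H r x Hs; specialize (Id r x Hs).
      unfold traces_sum in Id; cbn [fold_right fst snd] in Id.
      assert (E : forall i, (1 <= i <= 8)%nat -> c i - d i = 0)
        by (intros i Hi; rewrite H by lia; ring).
      rewrite !E in Id by lia; lra.
Qed.

Lemma C1_iff_gap b1 b2 b3 c d :
  b1 + b2 + b3 = 1 -> C0_conditions c d ->
  (forall r x, side r x -> gap 1 b2 b3 c d r x = 0) <-> C1_conditions b1 b2 b3 c d.
Proof.
  intros Hb H0. replace b1 with (1 - b2 - b3) in * by lra; clear Hb b1.
  unfold C1_conditions.
  (* The right sides of the conditions are read off from the goal; once the identity [Id]
     is proved, they may be arbitrary numbers. *)
  match goal with |- _ <-> (_ = ?F9 /\ _ = ?F15 /\ _ = ?F10 /\ _ = ?F14 /\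
      _ = ?F11 /\ _ = ?F13 /\ _ = ?F12) =>
    assert (Id : forall r x, side r x -> 1024 * gap 1 b2 b3 c d r x =
      traces_sum r 1 x [(F9 - d 9%nat, 9%nat); (F15 - d 15%nat, 15%nat);
         (F10 - d 10%nat, 10%nat); (F14 - d 14%nat, 14%nat);
         (F11 - d 11%nat, 11%nat); (F13 - d 13%nat, 13%nat); (F12 - d 12%nat, 12%nat)]);
    [|revert Id; generalize F9 F15 F10 F14 F11 F13 F12;
      intros f9 f15 f10 f14 f11 f13 f12 Id]
  end.
  - intros r x [[-> _]|[-> _]]; unfold gap; expand_traces;
    use_C0 H0;
    field.
  - split.
    + intros H.
      destruct (traces_independent1 (f9 - d 9%nat) (f15 - d 15%nat) (f10 - d 10%nat)
        (f14 - d 14%nat) (f11 - d 11%nat) (f13 - d 13%nat) (f12 - d 12%nat))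
        as (G9 & G15 & G10 & G14 & G11 & G13 & G12).
      { intros r x Hs; rewrite <- (Id r x Hs), H by assumption; ring. }
      repeat split; lra.
    + intros (G9 & G15 & G10 & G14 & G11 & G13 & G12) r x Hs; specialize (Id r x Hs).
      unfold traces_sum in Id; cbn [fold_right fst snd] in Id.
      rewrite G9, G15, G10, G14, G11, G13, G12 in Id; lra.
Qed.

Lemma C2_iff_gap b1 b2 b3 c d :
  b1 + b2 + b3 = 1 -> C0_conditions c d -> C1_conditions b1 b2 b3 c d ->
  (forall r x, side r x -> gap 2 b2 b3 c d r x = 0) <-> C2_conditions b1 b2 b3 c d.
Proof.
  intros Hb H0 H1. replace b1 with (1 - b2 - b3) in * by lra; clear Hb b1.
  unfold C2_conditions.
  match goal with |- _ <-> (_ = ?F16 /\ _ = ?F17 /\ _ = ?F18 /\ _ = ?F19 /\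
      _ = ?F20 /\ _ = ?F21) =>
    assert (Id : forall r x, side r x -> 1024 * gap 2 b2 b3 c d r x =
      traces_sum r 2 x [(F16 - d 16%nat, 16%nat); (F17 - d 17%nat, 17%nat);
         (F18 - d 18%nat, 18%nat); (F19 - d 19%nat, 19%nat);
         (F20 - d 20%nat, 20%nat); (F21 - d 21%nat, 21%nat)]);
    [|revert Id; generalize F16 F17 F18 F19 F20 F21;
      intros f16 f17 f18 f19 f20 f21 Id]
  end.
  - destruct H1 as (E9 & E15 & E10 & E14 & E11 & E13 & E12).
    intros r x [[-> _]|[-> _]]; unfold gap; expand_traces;
    rewrite E9, E10, E11, E12, E13, E14, E15;
    use_C0 H0;
    field.
  - split.
    + intros H.
      destruct (traces_independent2 (f16 - d 16%nat) (f17 - d 17%nat) (f18 - d 18%nat)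
        (f19 - d 19%nat) (f20 - d 20%nat) (f21 - d 21%nat))
        as (G16 & G17 & G18 & G19 & G20 & G21).
      { intros r x Hs; rewrite <- (Id r x Hs), H by assumption; ring. }
      repeat split; lra.
    + intros (G16 & G17 & G18 & G19 & G20 & G21) r x Hs; specialize (Id r x Hs).
      unfold traces_sum in Id; cbn [fold_right fst snd] in Id.
      rewrite G16, G17, G18, G19, G20, G21 in Id; lra.
Qed.

(** The factor 15 is 3! times 5/2, where 5/2 x^2 y^3 is the term by which the difference
    fails to vanish to order 3 on the first half when the right side of the last condition
    is 1 and the others hold. *)
Lemma C3_iff_gap b1 b2 b3 c d :
  b1 + b2 + b3 = 1 -> C0_conditions c d -> C1_conditions b1 b2 b3 c d ->
  C2_conditions b1 b2 b3 c d ->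
  (forall r x, side r x -> gap 3 b2 b3 c d r x = 0) <-> C3_conditions b1 b2 b3 c d.
Proof.
  intros Hb H0 H1 H2. replace b1 with (1 - b2 - b3) in * by lra; clear Hb b1.
  unfold C3_conditions.
  match goal with |- _ <-> (_ = ?F22 /\ _ = ?F23 /\ _ = ?F24 /\ _ = ?F25 /\ 0 = ?Z) =>
    assert (Id : forall r x, side r x -> 1024 * gap 3 b2 b3 c d r x =
      traces_sum r 3 x [(F22 - d 22%nat, 22%nat); (F23 - d 23%nat, 23%nat);
         (F24 - d 24%nat, 24%nat); (F25 - d 25%nat, 25%nat)]
      + 15 * 1024 * Z * (if (r =? 1)%nat then x * x else (2 - x) * (2 - x)));
    [|revert Id; generalize F22 F23 F24 F25 Z;
      intros f22 f23 f24 f25 z Id]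
  end.
  - destruct H1 as (E9 & E15 & E10 & E14 & E11 & E13 & E12).
    destruct H2 as (E16 & E17 & E18 & E19 & E20 & E21).
    intros r x [[-> _]|[-> _]]; unfold gap; expand_traces;
    rewrite E9, E10, E11, E12, E13, E14, E15, E16, E17, E18, E19, E20, E21;
    use_C0 H0;
    field.
  - split.
    + intros H.
      destruct (traces_independent3 (f22 - d 22%nat) (f23 - d 23%nat) (f24 - d 24%nat)
        (f25 - d 25%nat) (15 * 1024 * z))
        as (G22 & G23 & G24 & G25 & G).
      { intros r x Hs; rewrite <- (Id r x Hs), H by assumption; ring. }
      repeat split; lra.
    + intros (G22 & G23 & G24 & G25 & G) r x Hs; specialize (Id r x Hs).
      unfold traces_sum in Id; cbn [fold_right fst snd] in Id.
      rewrite G22, G23, G24, G25, <- G in Id; lra.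
Qed.

(** * The smooth join of the two splines *)

Lemma hull_edge v1 v2 v3 p :
  det v1 v2 v3 <> 0 ->
  hull (vertex v1 v2 v3) edge12 p <->
  0 <= fst (chart v1 v2 v3 p) <= 2 /\ snd (chart v1 v2 v3 p) = 0.
Proof. intros D; rewrite (hull_chart v1 v2 v3 D), hull_ref_edge; reflexivity. Qed.

Lemma hull_edge_whole v1 v2 v3 p :
  det v1 v2 v3 <> 0 ->
  hull (vertex v1 v2 v3) edge12 p -> hull (vertex v1 v2 v3) whole_triangle p.
Proof.
  intros D H; apply (hull_edge _ _ _ _ D) in H.
  apply (hull_chart v1 v2 v3 D), hull_ref_whole; unfold in_ref; lra.
Qed.

(** The point with coordinates (x, y) in the second triangle is
    v1 + x/2 (v2 - v1) + y/2 (v3' - v1), and v3' - v1 = b2 (v2 - v1) + b3 (v3 - v1). *)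
Lemma chart_shear v1 v2 v3 v3' b1 b2 b3 p :
  det v1 v2 v3 <> 0 -> det v1 v2 v3' <> 0 -> barycentric v1 v2 v3 v3' b1 b2 b3 ->
  chart v1 v2 v3 p = shear b2 b3 (chart v1 v2 v3' p).
Proof.
  intros D D' (Hb & Hx & Hy).
  assert (E : forall q, unchart v1 v2 v3 (shear b2 b3 q) = unchart v1 v2 v3' q).
  { intros [x y]; unfold unchart, shear, affine_map, affine, unchartX, unchartY.
    cbn [fst snd]; rewrite Hx, Hy; replace b1 with (1 - b2 - b3) by lra; f_equal; field. }
  rewrite <- (unchart_chart v1 v2 v3' D' p) at 1.
  now rewrite <- E, chart_unchart.
Qed.

Lemma barycentric_nonzero v1 v2 v3 v3' b1 b2 b3 :
  det v1 v2 v3' <> 0 -> barycentric v1 v2 v3 v3' b1 b2 b3 -> b3 <> 0.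
Proof.
  intros D' (Hb & Hx & Hy) E; apply D'; unfold det; rewrite Hx, Hy, E.
  replace b1 with (1 - b2) by lra; ring.
Qed.

Section Join.
Variables (v1 v2 v3 v3' : point) (B : list wspline) (c d : nat -> R) (b1 b2 b3 : R).
Hypothesis hT : det v1 v2 v3 <> 0.
Hypothesis hT' : det v1 v2 v3' <> 0.
Hypothesis hB : Bc_ordering B.
Hypothesis hb : barycentric v1 v2 v3 v3' b1 b2 b3.

(** The difference of the two splines in the coordinates of the second triangle. *)
Let mismatch (q : point) : R := strip_spline B c (shear b2 b3 q) - strip_spline B d q.

Lemma mismatch_lin : mismatch = fun q => 1 * strip_spline B c (shear b2 b3 q) + (-1) * strip_spline B d q.
Proof. apply functional_extensionality; intros q; unfold mismatch; ring. Qed.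

Lemma smooth_mismatch : smooth 3 mismatch.
Proof.
  rewrite mismatch_lin; apply smooth_plus; apply smooth_scal; [|apply smooth_strip_spline].
  apply smooth_comp, smooth_strip_spline.
Qed.

Lemma iter_dy_mismatch r k x :
  side r x -> (k <= 3)%nat -> Nat.iter k dy mismatch (x, 0) = gap k b2 b3 c d r x.
Proof.
  intros Hr Hk; rewrite mismatch_lin, iter_dy_dir_deriv, iter_dir_deriv_lin, <- !iter_dy_dir_deriv.
  - rewrite (iter_dy_strip B r k b2 b3 c x hB Hr Hk).
    assert (E : (fun q => strip_spline B d (shear 0 1 q)) = strip_spline B d).
    { apply functional_extensionality; intros [u v].
      unfold shear, affine_map, affine; cbn [fst snd]; do 2 f_equal; ring. }
    rewrite <- E, (iter_dy_strip B r k 0 1 d x hB Hr Hk); unfold gap; ring.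
  - apply smooth_le with 3%nat; [assumption|]. apply smooth_comp, smooth_strip_spline.
  - apply smooth_le with 3%nat; [assumption|]. apply smooth_strip_spline.
Qed.

Lemma side_left x : 0 < x < 1 -> side 1 x.
Proof. left; auto. Qed.

Lemma side_right x : 1 < x < 2 -> side 4 x.
Proof. right; auto. Qed.

(** The open halves are dense in the edge. *)
Lemma edge_point x :
  0 <= x <= 2 -> forall P, locally (x, 0) P ->
  exists r y, side r y /\ P (y, 0).
Proof.
  intros Hx P HP. destruct (locally_line_x P (x, 0) HP) as [eps He]; cbn [fst snd] in He.
  assert (Hball : forall y, Rabs (y - x) < eps -> P (y, 0)) by (intros y Hy; apply He; exact Hy).
  assert (He0 := cond_pos eps).
  (* Move by at most 1/2 from an end or from the midpoint into a half. *)
  set (h := Rmin (eps / 2) (1 / 2)).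
  assert (Hh : 0 < h < eps /\ h <= 1/2).
  { unfold h; pose proof (Rmin_l (eps / 2) (1 / 2)); pose proof (Rmin_r (eps / 2) (1 / 2)).
    assert (0 < Rmin (eps / 2) (1 / 2)) by (apply Rmin_pos; lra). lra. }
  destruct (Rlt_or_le x 1) as [H1|H1].
  - destruct (Rlt_or_le 0 x) as [H0|H0].
    + exists 1%nat, x; split; [apply side_left; lra | apply Hball; rewrite Rminus_diag, Rabs_R0; lra].
    + exists 1%nat, (x + h); split; [apply side_left; lra|].
      apply Hball; replace (x + h - x) with h by ring; rewrite Rabs_pos_eq; lra.
  - destruct (Rlt_or_le 1 x) as [H0|H0].
    + destruct (Rlt_or_le x 2) as [H2|H2].
      * exists 4%nat, x; split; [apply side_right; lra | apply Hball; rewrite Rminus_diag, Rabs_R0; lra].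
      * exists 4%nat, (x - h); split; [apply side_right; lra|].
        apply Hball; replace (x - h - x) with (- h) by ring.
        rewrite Rabs_Ropp, Rabs_pos_eq; lra.
    + exists 1%nat, (x - h); split; [apply side_left; lra|].
      apply Hball; replace (x - h - x) with (- h) by ring.
      rewrite Rabs_Ropp, Rabs_pos_eq; lra.
Qed.

Lemma flat_mismatch n :
  (n <= 3)%nat ->
  (forall x, 0 <= x <= 2 -> flat n mismatch (x, 0)) <->
  (forall k, (k <= n)%nat -> forall r x, side r x -> gap k b2 b3 c d r x = 0).
Proof.
  intros Hn; assert (Smis := smooth_le _ _ _ Hn smooth_mismatch); split.
  - intros H k Hk r x Hr. rewrite <- iter_dy_mismatch by (assumption || lia).
    apply flat_iter_dy with n; [|assumption].
    apply H; destruct Hr as [[_ Hr]|[_ Hr]]; lra.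
  - intros H x Hx. apply flat_limit; [assumption|]. intros P HP.
    destruct (edge_point x Hx P HP) as (r & y & Hr & Py).
    exists (y, 0); split; [assumption|].
    destruct Hr as [[Er Hy]|[Er Hy]].
    + apply (flat_axis n mismatch 0 1); [assumption | | assumption].
      intros k t Hk Ht; rewrite iter_dy_mismatch with (r := 1%nat) by (auto using side_left; lia).
      apply H; [assumption | now apply side_left].
    + apply (flat_axis n mismatch 1 2); [assumption | | assumption].
      intros k t Hk Ht; rewrite iter_dy_mismatch with (r := 4%nat) by (auto using side_right; lia).
      apply H; [assumption | now apply side_right].
Qed.

(** The join in terms of the derivatives across the edge, on its two open halves. *)
Lemma join_iff_gap n :
  (n <= 3)%nat ->
  smooth_join n (hull (vertex v1 v2 v3) edge12)
    (hull (vertex v1 v2 v3) whole_triangle) (hull (vertex v1 v2 v3') whole_triangle)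
    (spline (vertex v1 v2 v3) B c) (spline (vertex v1 v2 v3') B d)
  <-> (forall k, (k <= n)%nat -> forall r x, side r x -> gap k b2 b3 c d r x = 0).
Proof.
  intros Hn; assert (Smis := smooth_le _ _ _ Hn smooth_mismatch).
  assert (b30 := barycentric_nonzero _ _ _ _ _ _ _ hT' hb).
  assert (EA := fun p => chart_shear _ _ _ _ _ _ _ p hT hT' hb).
  assert (HB : forall b, In b B -> in_Bc b) by (intros b; apply hB).
  assert (Edge : forall p, hull (vertex v1 v2 v3) edge12 p <->
            exists x, 0 <= x <= 2 /\ chart v1 v2 v3' p = (x, 0)).
  { intros p; rewrite hull_edge, EA by assumption.
    destruct (chart v1 v2 v3' p) as [x y]; unfold shear, affine_map, affine; cbn [fst snd].
    split.
    - intros (Hx & Hy). assert (y = 0).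
      { destruct (Rmult_integral b3 y); [lra | contradiction | assumption]. }
      subst y; exists x; split; [lra | reflexivity].
    - intros (x' & Hx & [= -> ->]); lra. }
  assert (Edge' : forall p, hull (vertex v1 v2 v3) edge12 p -> hull (vertex v1 v2 v3') edge12 p).
  { intros p Hp; apply Edge in Hp; destruct Hp as (x & Hx & E).
    apply hull_edge; [assumption|]; rewrite E; cbn [fst snd]; lra. }
  assert (Near : forall w3 e, det v1 v2 w3 <> 0 -> forall p, hull (vertex v1 v2 w3) edge12 p ->
    locally p (fun z => hull (vertex v1 v2 w3) whole_triangle z ->
       spline (vertex v1 v2 w3) B e z = strip_spline B e (chart v1 v2 w3 z))).
  { intros w3 e D p Hp; apply (hull_edge _ _ _ _ D) in Hp; destruct Hp as [_ Hy].
    apply (filter_imp (fun z => snd (chart v1 v2 w3 z) < 1/2)).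
    - intros z Hz Tz; now apply spline_strip.
    - apply (continuous_affine (chartY v1 v2 w3) p (fun y => y < 1/2)).
      apply (locally_open (fun y => y < 1/2)); [apply open_lt | auto |].
      change (snd (chart v1 v2 w3 p) < 1/2); rewrite Hy; lra. }
  rewrite <- flat_mismatch by assumption.
  rewrite (smooth_join_flat n _ _ _ _ _ (fun z => strip_spline B c (chart v1 v2 v3 z))
             (fun z => strip_spline B d (chart v1 v2 v3' z))).
  - assert (Emis : (fun z => strip_spline B c (chart v1 v2 v3 z) - strip_spline B d (chart v1 v2 v3' z))
       = fun z => mismatch (chart v1 v2 v3' z))
      by (apply functional_extensionality; intros z; unfold mismatch; now rewrite EA).
    rewrite Emis; split.
    + intros H x Hx.
      assert (F : flat n (fun z => mismatch (chart v1 v2 v3' z)) (unchart v1 v2 v3' (x, 0))).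
      { apply H, Edge; exists x; split; [assumption | now apply chart_unchart]. }
      apply (flat_comp (unchartX v1 v2 v3') (unchartY v1 v2 v3')) in F;
        [|now apply smooth_comp].
      replace mismatch with (fun q => mismatch (chart v1 v2 v3' (unchart v1 v2 v3' q))); [exact F|].
      apply functional_extensionality; intros q; now rewrite chart_unchart.
    + intros H p Hp; apply Edge in Hp; destruct Hp as (x & Hx & E).
      apply (flat_comp (chartX v1 v2 v3') (chartY v1 v2 v3')); [assumption|].
      fold (chart v1 v2 v3'); rewrite E; now apply H.
  - intros p Hp; apply interior_adherent; [assumption|]; now apply hull_edge_whole.
  - intros p Hp; apply interior_adherent; [assumption|].
    apply hull_edge_whole; [assumption|]; now apply Edge'.
  - intros p Hp; now apply Near.
  - intros p Hp; apply Near; [assumption|]; now apply Edge'.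
  - apply smooth_comp, smooth_le with 3%nat; [assumption|]; apply smooth_strip_spline.
  - apply smooth_comp, smooth_le with 3%nat; [assumption|]; apply smooth_strip_spline.
Qed.
End Join.

Theorem theorem9 (v1 v2 v3 v3' : point) (B : list wspline)
  (c d : nat -> R) (b1 b2 b3 : R)
  (hT : det v1 v2 v3 <> 0) (hT' : det v1 v2 v3' <> 0)
  (hB : Bc_ordering B)
  (hb : barycentric v1 v2 v3 v3' b1 b2 b3) :
  let V := vertex v1 v2 v3 in
  let V' := vertex v1 v2 v3' in
  let join r := smooth_join r (hull V edge12)
                  (hull V whole_triangle) (hull V' whole_triangle)
                  (spline V B c) (spline V' B d) in
  (join 0%nat <-> C0_conditions c d) /\
  (join 1%nat <-> C0_conditions c d /\ C1_conditions b1 b2 b3 c d) /\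
  (join 2%nat <-> C0_conditions c d /\ C1_conditions b1 b2 b3 c d /\
                  C2_conditions b1 b2 b3 c d) /\
  (join 3%nat <-> C0_conditions c d /\ C1_conditions b1 b2 b3 c d /\
                  C2_conditions b1 b2 b3 c d /\ C3_conditions b1 b2 b3 c d).
Proof.
  intros V V' join.
  assert (S := proj1 hb).
  assert (J : forall n, (n <= 3)%nat -> join n <-> (forall k, (k <= n)%nat ->
     forall r x, side r x -> gap k b2 b3 c d r x = 0))
    by (intros n; now apply join_iff_gap with b1).
  assert (O0 := C0_iff_gap b1 b2 b3 c d S). assert (O1 := C1_iff_gap b1 b2 b3 c d S).
  assert (O2 := C2_iff_gap b1 b2 b3 c d S). assert (O3 := C3_iff_gap b1 b2 b3 c d S).
  set (D k := forall r x, side r x -> gap k b2 b3 c d r x = 0).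
  change (D 0%nat <-> C0_conditions c d) in O0.
  change (C0_conditions c d -> D 1%nat <-> C1_conditions b1 b2 b3 c d) in O1.
  change (C0_conditions c d -> C1_conditions b1 b2 b3 c d ->
          D 2%nat <-> C2_conditions b1 b2 b3 c d) in O2.
  change (C0_conditions c d -> C1_conditions b1 b2 b3 c d -> C2_conditions b1 b2 b3 c d ->
          D 3%nat <-> C3_conditions b1 b2 b3 c d) in O3.
  assert (K : forall n, (n <= 3)%nat -> join n <-> (forall k, (k <= n)%nat -> D k)) by exact J.
  assert (K0 : join 0%nat <-> D 0%nat).
  { rewrite K by lia; split; [intros H; apply H; lia|].
    intros H [|k] Hk; [assumption | lia]. }
  assert (KS : forall n, (n < 3)%nat -> join (Datatypes.S n) <-> join n /\ D (Datatypes.S n)).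
  { intros n Hn; rewrite !K by lia; split.
    - intros H; split; [intros k Hk; apply H; lia | apply H; lia].
    - intros [H HS] k Hk; destruct (Nat.eq_dec k (Datatypes.S n)) as [->|]; [assumption|].
      apply H; lia. }
  rewrite (KS 2%nat), (KS 1%nat), (KS 0%nat), K0 by lia; tauto.
Qed.
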